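(* Let $\mathcal{A}$ be a unital $C^{*}$-algebra, let $F,D\in B^{a}(H_{\mathcal{A}})$ and suppose that $\operatorname{Im}F$ and $\operatorname{Im}D$ are closed. Set $M=\operatorname{Im}F\cap(\ker D\cap\operatorname{Im}F)^{\perp}$ and $M'=\ker D\cap(\ker D\cap\operatorname{Im}F)^{\perp}$. Then the following are equivalent: (i) $\operatorname{Im}DF$ is closed; (ii) the Dixmier angle between $M'$ and $\operatorname{Im}F$ is positive; (iii) the Dixmier angle between $M$ and $\ker D$ is positive.
   Context: $H_{\mathcal{A}}=l_2(\mathcal{A})$ is the standard (right) Hilbert $C^{*}$-module over $\mathcal{A}$ of sequences $(a_i)_{i\in\mathbb{N}}$ in $\mathcal{A}$ with $\sum_i a_i^{*}a_i$ norm-convergent, and $B^{a}(H_{\mathcal{A}})$ is the set of bounded adjointable operators on it. For closed submodules $X,Y$ of $H_{\mathcal{A}}$ set $$c_0(X,Y)=\sup\{\|\langle x,y\rangle\| \mid x\in X,\ y\in Y,\ \|x\|,\|y\|\le 1\}.$$ The Dixmier angle between $X$ and $Y$ is said to be positive if $c_0(X,Y)<1$. *)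

(* Defs.v *)
From HB Require Import structures.
From mathcomp Require Import all_boot all_order all_algebra.
From mathcomp Require Import complex.
From mathcomp Require Import all_classical all_reals all_analysis.

Set Implicit Arguments.
Unset Strict Implicit.
Unset Printing Implicit Defensive.

Import Order.TTheory GRing.Theory Num.Theory.
Import numFieldNormedType.Exports.

Local Open Scope classical_set_scope.
Local Open Scope ring_scope.

(* Unital C*-algebras.  The multiplication and the unit are fields of the mixin
   because Hierarchy Builder admits no structure joining a ring and a normed
   module other than numDomainType and its extensions; the ring structure is a
   canonical instance, declared afterwards.  It is a pzRingType, so 1 = 0 (the
   zero algebra) is allowed.  The norm of a normedModType over R[i] takes its
   values in R[i]. *)
HB.mixin Record isCStarAlgebra (R : realType) A
    of CompleteNormedModule R[i] A := {
  cmul : A -> A -> A ;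
  cone : A ;
  cmulA : associative cmul ;
  cmul1r : left_id cone cmul ;
  cmulr1 : right_id cone cmul ;
  cmulDl : left_distributive cmul +%R ;
  cmulDr : right_distributive cmul +%R ;
  cmulZl : forall (k : R[i]) (a b : A), cmul (k *: a) b = k *: cmul a b ;
  cmulZr : forall (k : R[i]) (a b : A), cmul a (k *: b) = k *: cmul a b ;
  cnormM : forall a b : A, `|cmul a b| <= `|a| * `|b| ;
  star : A -> A ;
  starK : involutive star ;
  starD : {morph star : a b / a + b} ;
  starZ : forall (k : R[i]) (a : A), star (k *: a) = k^* *: star a ;
  starM : forall a b : A, star (cmul a b) = cmul (star b) (star a) ;
  cnorm_star : forall a : A, `|cmul (star a) a| = `|a| ^+ 2 }.

#[short(type="cstarAlgType")]
HB.structure Definition CStarAlgebra (R : realType) :=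
  { A of CompleteNormedModule R[i] A & isCStarAlgebra R A }.

HB.instance Definition _ (R : realType) (A : cstarAlgType R) :=
  GRing.Zmodule_isPzRing.Build (CStarAlgebra.sort A)
    (@cmulA R A) (@cmul1r R A) (@cmulr1 R A) (@cmulDl R A) (@cmulDr R A).

Section HilbertModule.
Context {R : realType} {A : cstarAlgType R}.
Implicit Types x y : nat -> A.

Definition rnorm (a : A) : R := complex.Re `|a|.

(* Conjugate-linear in the first variable.  Defined on all sequences: the
   value is the true inner product as soon as the series converges, which is
   always the case for two elements of [l2 A]. *)
Definition inner x y : A := limn (series (fun i => star (x i) * y i)).

Definition l2norm x : R := Num.sqrt (rnorm (inner x x)).

End HilbertModule.

Record l2 (R : realType) (A : cstarAlgType R) := L2 {
  l2seq :> nat -> A ;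
  l2P : cvgn (series (fun i => star (l2seq i) * l2seq i)) }.

(* [l2 A] is a submodule of [nat -> A], but it is not equipped here with its
   own module structure: sums and differences of its elements are taken
   coordinatewise, in [nat -> A].  In [adj_linear], [z] is [x + y a];
   C-linearity of an operator is A-linearity at scalar multiples of the unit. *)
Record adjointable (R : realType) (A : cstarAlgType R) := Adjointable {
  adj_fun :> l2 A -> l2 A ;
  adj_linear : forall (x y z : l2 A) (a : A),
    (forall i, z i = x i + y i * a) ->
    forall i, adj_fun z i = adj_fun x i + adj_fun y i * a ;
  adj_bounded : exists k : R, forall x : l2 A,
    l2norm (adj_fun x) <= k * l2norm x ;
  adj_exists : exists G : l2 A -> l2 A, forall x y : l2 A,
    inner (adj_fun x) y = inner x (G y) }.

Section Subsets.
Context {R : realType} {A : cstarAlgType R}.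
Implicit Types (X Y : set (l2 A)) (T : l2 A -> l2 A).

(* Closed for the topology of [l2norm]: [X] contains every point adherent to
   it. *)
Definition l2closed X : Prop :=
  forall x : l2 A,
    (forall e : R, 0 < e ->
      exists2 y : l2 A, X y & l2norm (fun i => x i - y i) < e) ->
    X x.

Definition ker T : set (l2 A) := [set x | forall i, T x i = 0].

Definition orth X : set (l2 A) :=
  [set y | forall x : l2 A, X x -> inner x y = 0].

Definition c0 X Y : \bar R :=
  ereal_sup [set r | exists x y : l2 A,
    [/\ X x, Y y, l2norm x <= 1, l2norm y <= 1 &
        r = (rnorm (inner x y))%:E]].

Definition dixmier_angle_pos X Y : Prop := (c0 X Y < 1%:E)%E.

End Subsets.

(* Main.v *)
Require Import Defs.
From HB Require Import structures.
From mathcomp Require Import all_boot all_order all_algebra.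
From mathcomp Require Import complex.
From mathcomp Require Import all_classical all_reals all_analysis.
From mathcomp Require Import ring lra.

Set Implicit Arguments.
Unset Strict Implicit.
Unset Printing Implicit Defensive.

Import Order.TTheory GRing.Theory Num.Theory.
Import numFieldNormedType.Exports.

Local Open Scope classical_set_scope.
Local Open Scope complex_scope.
Local Open Scope ring_scope.

(* Write K = ker D and N = Im F, with the orthogonal projections P and Q onto
   them.  P maps M into M', so the two angles are positive together.

   If the angle between M and K is positive, then QP is a strict contraction of
   M.  For x in N one has x - QPx in M, so solving m - QPm = x - QPx in M leaves
   x - m fixed by QP, that is, in the intersection of K and N; hence
   D(N) = D(M), and D is bounded below on M.  Conversely, if D(N) is closed, the
   open mapping property gives |y| <= C |y - Py| on M.  A norm inequality on a
   submodule upgrades to an inequality of A-valued inner products, so Pythagoras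
   turns this one into |Py| <= c |y| with c < 1.

   A closed range operator F is bounded below on its range by its adjoint
   (gliding hump); after the same upgrade, a Neumann series makes F F^* onto
   Im F, which complements Im F and ker F and gives the open mapping property.

   Positivity in A is obtained without spectral theory: h is positive when
   |t - h| <= t for some t >= 0, and square roots come from the iteration
   y <- (k + y^2) / 2, dominated by the same iteration for scalars. *)

(** * Limits, domination and Neumann series for a norm on an additive group *)

Section GroupNorm.
Variables (R : realType) (V : zmodType) (N : V -> R).

(** Common to [rnorm] on [A] and [l2norm] on [l2 A]; definiteness and completeness are separate
    premises where they are used. *)
Definition group_norm : Prop :=
  (forall x y, N (x + y) <= N x + N y) /\ (forall x, N (- x) = N x).

Definition tends_to (u : nat -> V) (l : V) : Prop :=
  forall e, 0 < e -> exists n0, forall n, (n0 <= n)%N -> N (u n - l) < e.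

Definition cauchy_for (u : nat -> V) : Prop :=
  forall e, 0 < e -> exists n0, forall m n, (n0 <= m)%N -> (n0 <= n)%N ->
    N (u m - u n) < e.

Definition complete_for : Prop :=
  forall u, cauchy_for u -> exists l, tends_to u l.

Hypothesis N_norm : group_norm.

Lemma gnormB_sym x y : N (x - y) = N (y - x).
Proof. by rewrite -N_norm.2 opprB. Qed.

Lemma gnorm_dist_triangle z x y : N (x - y) <= N (x - z) + N (z - y).
Proof. by have := N_norm.1 (x - z) (z - y); rewrite addrA subrK. Qed.

Lemma tends_to_bound u l (c : R) n1 :
  tends_to u l -> (forall n, (n1 <= n)%N -> N (u n) <= c) -> N l <= c.
Proof.
move=> ul uc; apply/ler_addgt0Pr => e e0.
have [n0 Hn0] := ul e e0.
have := N_norm.1 (u (maxn n0 n1)) (- (u (maxn n0 n1) - l)).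
rewrite N_norm.2 opprB addrC subrK => /le_trans; apply; apply: lerD.
  exact/uc/leq_maxr.
exact/ltW/Hn0/leq_maxl.
Qed.

Lemma tends_to_unique u l l' : (forall x, N x <= 0 -> x = 0) ->
  tends_to u l -> tends_to u l' -> l = l'.
Proof.
move=> N0 ul ul'; apply/subr0_eq/N0/ler_addgt0Pr => e e0.
have [n0 Hn0] := ul (e / 2) ltac:(lra).
have [n1 Hn1] := ul' (e / 2) ltac:(lra).
have H0 := Hn0 _ (leq_maxl n0 n1); have H1 := Hn1 _ (leq_maxr n0 n1).
have := gnorm_dist_triangle (u (maxn n0 n1)) l l'.
rewrite (gnormB_sym l (u _)) add0r; lra.
Qed.

Lemma tends_toD u v l m : tends_to u l -> tends_to v m ->
  tends_to (fun n => u n + v n) (l + m).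
Proof.
move=> ul vm e e0.
have [n0 Hn0] := ul (e / 2) ltac:(lra).
have [n1 Hn1] := vm (e / 2) ltac:(lra).
exists (maxn n0 n1) => n; rewrite geq_max => /andP[/Hn0 h0 /Hn1 h1].
rewrite opprD addrACA; have := N_norm.1 (u n - l) (v n - m); lra.
Qed.

Lemma tends_to_shift u l : tends_to u l -> tends_to (fun n => u n.+1) l.
Proof.
move=> ul e /ul[n0 Hn0]; exists n0 => n nn.
exact/Hn0/leqW.
Qed.

Lemma tends_to_cauchy u l : tends_to u l -> cauchy_for u.
Proof.
move=> ul e e0; have [n0 Hn0] := ul (e / 2) ltac:(lra).
exists n0 => m n /Hn0 Hm /Hn0 Hn.
have := gnorm_dist_triangle l (u m) (u n).
rewrite (gnormB_sym l); lra.
Qed.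

Section Dominated.
Variables (u : nat -> V) (b : nat -> R) (B : R).
Hypothesis ub : forall n, N (u n.+1 - u n) <= b n.+1 - b n.
Hypothesis bB : forall n, b n <= B.
Hypothesis N0 : N 0 = 0.

Lemma dominated_dist n m : (n <= m)%N -> N (u m - u n) <= b m - b n.
Proof.
elim: m => [|m IH].
  by rewrite leqn0 => /eqP ->; rewrite !subrr N0.
rewrite leq_eqVlt => /orP[/eqP ->|]; first by rewrite !subrr N0.
rewrite ltnS => /IH H.
have := gnorm_dist_triangle (u m) (u m.+1) (u n); have := ub m; lra.
Qed.

(** [b] is nondecreasing and bounded, so past an index where it is within [e] of its supremum its
    increments, and with them those of [u], stay below [e]. *)
Lemma dominated_cauchy : (forall x, 0 <= N x) -> cauchy_for u.
Proof.
move=> Nge0 e e0.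
have b_nd n m : (n <= m)%N -> b n <= b m.
  move=> /dominated_dist; have := Nge0 (u m - u n); lra.
pose S := range b.
have S_sup : has_sup S.
  split; first by exists (b 0), 0.
  by exists B => _ [n _ <-].
have [_ [n0 _ <-] Hn0] := sup_adherent e0 S_sup.
have le_sup n : b n <= sup S by apply: ub_le_sup; [exact: S_sup.2|exists n].
exists n0 => m n n0m n0n.
wlog mn : m n n0m n0n / (n <= m)%N.
  move=> H; have [/H|/ltnW/H] := leqP n m; first exact.
  by rewrite gnormB_sym; apply.
apply: (le_lt_trans (dominated_dist mn)).
have := b_nd _ _ n0n; have := le_sup m; lra.
Qed.

Lemma dominated_lim_dist l n : tends_to u l -> N (l - u n) <= B - b n.
Proof.
move=> ul.
apply: (@tends_to_bound (fun m => u m - u n) _ _ n).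
  move=> e /ul[n0 Hn0]; exists n0 => m /Hn0.
  by rewrite opprB addrA subrK.
by move=> m /dominated_dist /le_trans; apply; rewrite lerD2r.
Qed.

End Dominated.

(** The iterates of [x |-> z + S x] from 0 stay in [X] and converge to the solution. The premises on
    [S] are restricted to [X] because the operators in view contract only a submodule. *)
Lemma neumann_solve (X : set V) (S : V -> V) (q : R) (z : V) :
  (forall x, 0 <= N x) -> N 0 = 0 -> (forall x, N x <= 0 -> x = 0) ->
  complete_for ->
  (forall u l, (forall n, X (u n)) -> tends_to u l -> X l) ->
  (forall x y, X x -> X y -> X (x + y)) ->
  (forall x, X x -> X (S x)) ->
  (forall x y, X x -> X y -> S (x - y) = S x - S y) ->
  0 <= q < 1 -> (forall x, X x -> N (S x) <= q * N x) -> X 0 -> X z ->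
  (forall x, X x -> X (- x)) ->
  exists2 x, X x & x - S x = z.
Proof.
move=> Nge0 N0 Ndef cpl Xcl XD XS SB /andP[q0 q1] Sq X0 Xz XN.
pose u n := iter n (fun x => z + S x) 0.
have Xu n : X (u n) by elim: n => //= n IH; apply/XD => //; exact: XS.
have q'0 : 0 < 1 - q by lra.
(* Minus the tail of the geometric series: its increments are [q ^+ n * N z] and 0 is an upper
   bound. *)
pose b n := - (q ^+ n * (N z / (1 - q))).
have NSu n : N (u n.+1 - u n) <= q ^+ n * N z.
  elim: n => [|n IH].
    rewrite /u /= subr0 -(subr0 (0 : V)) SB// subrr addr0 expr0 mul1r//.
  rewrite [X in N X](_ : _ = S (u n.+1 - u n)); last first.
    by rewrite SB// /u /= opprD addrACA subrr add0r.
  apply: (le_trans (Sq _ _)).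
    exact/XD/XN.
  by rewrite exprS -mulrA ler_wpM2l.
have ub n : N (u n.+1 - u n) <= b n.+1 - b n.
  apply: (le_trans (NSu n)); rewrite /b opprK exprS.
  rewrite [leRHS](_ : _ = q ^+ n * N z)//; field; lra.
have bB n : b n <= 0.
  by rewrite oppr_le0 mulr_ge0 ?exprn_ge0// divr_ge0// ltW.
have [x ux] := cpl _ (dominated_cauchy ub bB N0 Nge0).
have Xx := Xcl _ _ Xu ux.
exists x => //.
apply/subr0_eq/Ndef/ler_addgt0Pr => e e0; rewrite add0r.
have [n0 Hn0] := ux (e / 2) ltac:(lra).
have H0 := Hn0 _ (leqnn n0); have H1 := Hn0 _ (leqnSn n0).
rewrite [X in N X](_ : _ = (x - u n0.+1) + (S (u n0 - x))); last first.
  rewrite SB// [u n0.+1]/(z + S (u n0)) opprD !addrA.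
  by rewrite subrK [in RHS]addrAC.
apply: (le_trans (N_norm.1 _ _)).
have : N (S (u n0 - x)) <= q * N (u n0 - x) by apply/Sq/XD/XN.
have : q * N (u n0 - x) <= N (u n0 - x) by apply: ler_piMl => //; lra.
rewrite (gnormB_sym x); lra.
Qed.

End GroupNorm.

(** * Positivity in C*-algebras *)

Section Algebra.
Variables (R : realType) (A : cstarAlgType R).
Implicit Types (a b c h k : A) (t : R).

Lemma normE a : `|a| = (rnorm a)%:C.
Proof. by rewrite /rnorm RRe_real// normr_real. Qed.

Lemma rnorm_ge0 a : 0 <= rnorm a.
Proof. by rewrite -ler0c -normE. Qed.

Lemma rnormD a b : rnorm (a + b) <= rnorm a + rnorm b.
Proof. by have := ler_normD a b; rewrite !normE -rmorphD lecR. Qed.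

Lemma rnormN a : rnorm (- a) = rnorm a.
Proof. by rewrite /rnorm normrN. Qed.

Lemma rnorm0 : rnorm (0 : A) = 0.
Proof. by rewrite /rnorm normr0. Qed.

Lemma rnorm_le0 a : rnorm a <= 0 -> a = 0.
Proof. by rewrite -(lecR (rnorm a)) -normE normr_le0 => /eqP. Qed.

Lemma rnormZ t a : rnorm (t%:C *: a) = `|t| * rnorm a.
Proof.
apply: complexI; have := normrZ t%:C a.
by rewrite !normE normc_def /= expr0n addr0 sqrtr_sqr -rmorphM.
Qed.

Lemma rnormM a b : rnorm (a * b) <= rnorm a * rnorm b.
Proof. by have := cnormM a b; rewrite !normE -rmorphM lecR. Qed.

Lemma rnorm_starM a : rnorm (star a * a) = rnorm a ^+ 2.
Proof.
by apply: complexI; have := cnorm_star a; rewrite !normE -rmorphXn.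
Qed.

Lemma starDr a b : star (a + b) = star a + star b. Proof. exact: starD. Qed.
Lemma starMr a b : star (a * b) = star b * star a. Proof. exact: starM. Qed.
Lemma starZR t a : star (t%:C *: a) = t%:C *: star a.
Proof. by rewrite starZ; congr (_ *: _); exact: conjc_real. Qed.
Lemma starZi a : star ('i *: a) = - ('i *: star a).
Proof. by rewrite starZ -scaleNr; congr (_ *: _); apply/eqP;
rewrite eq_complex /= oppr0 !eqxx. Qed.
Lemma star0 : star 0 = 0 :> A.
Proof. by apply: (addrI (star 0)); rewrite -starDr !addr0. Qed.
Lemma starN a : star (- a) = - star a.
Proof. by apply: (addrI (star a)); rewrite -starDr !subrr star0. Qed.
Lemma starB a b : star (a - b) = star a - star b.
Proof. by rewrite starDr starN. Qed.
Lemma star1 : star 1 = 1 :> A.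
Proof. by rewrite -[LHS]mul1r -{1}[1]starK -starMr mul1r starK. Qed.

Lemma scaleAl (k : R[i]) a b : k *: (a * b) = (k *: a) * b.
Proof. by rewrite -[RHS]/(cmul _ _) cmulZl. Qed.
Lemma scaleAr (k : R[i]) a b : k *: (a * b) = a * (k *: b).
Proof. by rewrite -[RHS]/(cmul _ _) cmulZr. Qed.

Lemma rnorm_star a : rnorm (star a) = rnorm a.
Proof.
suff H b : rnorm b <= rnorm (star b).
  by apply/eqP; rewrite eq_le H andbT; have := H (star a); rewrite starK.
have := rnormM (star b) b; rewrite rnorm_starM expr2.
have := rnorm_ge0 b; rewrite le_eqVlt => /orP[/eqP <- _|b0].
  exact: rnorm_ge0.
by rewrite ler_pM2r.
Qed.

Lemma rnorm1_le : rnorm (1 : A) <= 1.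
Proof.
have := rnorm_starM 1; rewrite star1 mul1r => e.
have := rnorm_ge0 1; nra.
Qed.

Lemma rnorm_sqr_sa a : star a = a -> rnorm (a * a) = rnorm a ^+ 2.
Proof. by move=> sa; rewrite -rnorm_starM sa. Qed.

Lemma rnorm_group : group_norm (@rnorm R A).
Proof. by split; [exact: rnormD|exact: rnormN]. Qed.

(** A positive element of [R[i]] is real, so the [R[i]]-valued norm and [rnorm] test convergence
    with the same radii. *)
Lemma tends_to_cvg (u : nat -> A) (l : A) :
  tends_to (@rnorm R A) u l <-> u @ \oo --> l.
Proof.
split=> [ul|/cvgrPdist_lt ul e e0].
  apply/cvgrPdist_lt => e; rewrite ltcE => /andP[/eqP ei er].
  have [n0 Hn0] := ul _ er.
  exists n0 => // n /= n0n; rewrite distrC normE ltcE /= ei eqxx /=.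
  exact: Hn0.
have /ul[n0 _ Hn0] : 0 < e%:C by rewrite ltcR.
exists n0 => n n0n; rewrite -ltcR -normE distrC.
exact: Hn0.
Qed.

Lemma complete_rnorm : complete_for (@rnorm R A).
Proof.
move=> u cu.
have : cvgn u.
  apply/cauchy_cvgP/cauchy_exP => e.
  rewrite ltcE => /andP[/eqP ei er].
  have [n0 Hn0] := cu _ er.
  exists (u n0); exists n0 => // n /= n0n.
  rewrite -ball_normE /ball_ /= normE ltcE /= ei eqxx /=.
  exact: Hn0.
by move=> cvu; exists (limn u); apply/tends_to_cvg.
Qed.

Lemma tends_to_lim (u : nat -> A) (l : A) :
  tends_to (@rnorm R A) u l -> limn u = l.
Proof. by move=> /tends_to_cvg ul; exact/cvg_lim. Qed.

Lemma rnorm_tends_to_uniq (u : nat -> A) (l l' : A) :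
  tends_to (@rnorm R A) u l -> tends_to (@rnorm R A) u l' -> l = l'.
Proof. by apply: tends_to_unique; [exact: rnorm_group|exact: rnorm_le0]. Qed.

Lemma tends_toMl b (u : nat -> A) (l : A) :
  tends_to (@rnorm R A) u l -> tends_to (@rnorm R A) (fun n => b * u n) (b * l).
Proof.
move=> ul e e0.
have [n0 Hn0] := ul (e / (rnorm b + 1)) ltac:(by rewrite divr_gt0// ltr_wpDl// rnorm_ge0).
exists n0 => n /Hn0; rewrite -mulrBr ltr_pdivlMr ?ltr_wpDl ?rnorm_ge0// => H.
apply: (le_lt_trans (rnormM _ _)).
have := rnorm_ge0 (u n - l); have := rnorm_ge0 b; nra.
Qed.

Lemma tends_to_star (u : nat -> A) (l : A) :
  tends_to (@rnorm R A) u l ->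
  tends_to (@rnorm R A) (fun n => star (u n)) (star l).
Proof.
by move=> ul e /ul[n0 Hn0]; exists n0 => n /Hn0; rewrite -starB rnorm_star.
Qed.

Lemma tends_toMr b (u : nat -> A) (l : A) :
  tends_to (@rnorm R A) u l -> tends_to (@rnorm R A) (fun n => u n * b) (l * b).
Proof.
move=> /tends_to_star/(tends_toMl (star b))/tends_to_star.
by under [X in tends_to _ X]eq_fun do rewrite starMr !starK; rewrite starMr !starK.
Qed.

End Algebra.

(** * Square roots of [1 - k] by iteration *)

Section Sqrt.
Variables (R : realType) (A : cstarAlgType R).
Implicit Types (a b c h k m r s : A) (t : R).

(** A fixed point [y] of [y = (k + y * y) / 2] satisfies [(1 - y) ^+ 2 = 1 - k]. *)
Fixpoint qiter k n : A :=
  if n is n'.+1 then (2^-1)%:C *: (k + qiter k n' * qiter k n') else 0.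

Definition qlim k : A := limn (qiter k).

(** The scalar case [k = 1], whose increments dominate those of [qiter k] when [rnorm k <= 1]. *)
Fixpoint eta n : R := if n is n'.+1 then 2^-1 * (1 + eta n' * eta n') else 0.

Lemma eta_bound n : 0 <= eta n <= 1.
Proof. by elim: n => [|n /andP[h0 h1]] /=; [rewrite lexx ler01|nra]. Qed.

(** [qiter] is polynomial in its argument. Taking [k = m] gives commutation; two different elements
    are needed for the pair [b * star b], [star b * b]. *)
Lemma qiter_intertwine k m b n : k * b = b * m -> qiter k n * b = b * qiter m n.
Proof.
move=> kb; elim: n => [|n IH] /=; first by rewrite mul0r mulr0.
rewrite -scaleAl -scaleAr; congr (_ *: _).
by rewrite mulrDl mulrDr kb -mulrA IH !mulrA IH.
Qed.

Lemma qiter_comm k n n' : qiter k n * qiter k n' = qiter k n' * qiter k n.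
Proof. by apply: qiter_intertwine; apply/esym/qiter_intertwine. Qed.

Lemma star_qiter k n : star (qiter k n) = qiter (star k) n.
Proof.
elim: n => [|n IH] /=; first exact: star0.
by rewrite starZR starDr starMr IH.
Qed.

Lemma rnormZ_half a : rnorm ((2^-1)%:C *: a) = 2^-1 * rnorm a.
Proof. by rewrite rnormZ ger0_norm// invr_ge0. Qed.

Section Convergence.
Variable k : A.
Hypothesis k_le1 : rnorm k <= 1.

Lemma rnorm_qiter n : rnorm (qiter k n) <= eta n.
Proof.
elim: n => [|n IH] /=; first by rewrite rnorm0.
rewrite rnormZ_half ler_pM2l ?invr_gt0//.
apply: (le_trans (rnormD _ _)); apply: lerD => //.
apply: (le_trans (rnormM _ _)); apply: ler_pM => //; exact: rnorm_ge0.
Qed.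

Lemma rnorm_qiter_step n :
  rnorm (qiter k n.+1 - qiter k n) <= eta n.+1 - eta n.
Proof.
elim: n => [|n IH].
  by rewrite !subr0; exact: rnorm_qiter 1%N.
rewrite [qiter k n.+2]/((2^-1)%:C *: (k + qiter k n.+1 * qiter k n.+1)).
rewrite [X in _ - X]/((2^-1)%:C *: (k + qiter k n * qiter k n)).
(* The iterates commute, so the difference of squares factors, exactly as it does for [eta]. *)
have -> : (2^-1)%:C *: (k + qiter k n.+1 * qiter k n.+1) -
    (2^-1)%:C *: (k + qiter k n * qiter k n) =
    (2^-1)%:C *: ((qiter k n.+1 + qiter k n) * (qiter k n.+1 - qiter k n)).
  rewrite -scalerBr opprD addrACA subrr add0r mulrDl !mulrBr.
  by rewrite (qiter_comm k n.+1 n) addrA subrK.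
rewrite rnormZ_half; set y := qiter k n.+1 in IH *; set x := qiter k n in IH *.
have := rnormM (y + x) (y - x); have := rnormD y x.
have : rnorm y <= eta n.+1 := rnorm_qiter n.+1.
have := rnorm_qiter n; rewrite -/x.
have := rnorm_ge0 (y - x); have := rnorm_ge0 (y + x).
have -> : eta n.+2 - eta n.+1 =
    2^-1 * ((eta n.+1 + eta n) * (eta n.+1 - eta n)).
  by rewrite /=; field.
move=> yx0 yx1 xe ye yxD yxM; rewrite ler_pM2l ?invr_gt0//.
by apply: (le_trans yxM); apply: ler_pM => //; lra.
Qed.

Lemma qiter_cvg : tends_to (@rnorm R A) (qiter k) (qlim k).
Proof.
have eta1 n : eta n <= 1 by case/andP: (eta_bound n).
have cy := dominated_cauchy (rnorm_group A) rnorm_qiter_step eta1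
  (rnorm0 A) (@rnorm_ge0 _ _).
have [l yl] := complete_rnorm cy.
by rewrite /qlim (tends_to_lim yl).
Qed.

Lemma rnorm_qlim : rnorm (qlim k) <= 1.
Proof.
apply: (tends_to_bound (n1 := 0) (rnorm_group A) qiter_cvg) => n _.
by apply: (le_trans (rnorm_qiter n)); case/andP: (eta_bound n).
Qed.

Lemma sqr_1Bqlim : (1 - qlim k) * (1 - qlim k) = 1 - k.
Proof.
set y := qlim k.
have yE : y = (2^-1)%:C *: (k + y * y).
  apply: (rnorm_tends_to_uniq (tends_to_shift qiter_cvg)) => e e0.
  have [n0 Hn0] := qiter_cvg e0; exists n0 => n /Hn0 H /=.
  rewrite -scalerBr opprD addrACA subrr add0r rnormZ_half.
  have -> : qiter k n * qiter k n - y * y =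
      qiter k n * (qiter k n - y) + (qiter k n - y) * y.
    by rewrite mulrBr mulrBl addrA subrK.
  have := rnormD (qiter k n * (qiter k n - y)) ((qiter k n - y) * y).
  have := rnormM (qiter k n) (qiter k n - y).
  have := rnormM (qiter k n - y) y.
  have : rnorm (qiter k n) <= 1.
    by apply: (le_trans (rnorm_qiter n)); case/andP: (eta_bound n).
  have : rnorm y <= 1 := rnorm_qlim.
  have := rnorm_ge0 (qiter k n); have := rnorm_ge0 y.
  have := rnorm_ge0 (qiter k n - y).
  by rewrite -/y in H; nra.
have -> : (1 - y) * (1 - y) = 1 - (y + y - y * y).
  by rewrite mulrBl mul1r mulrBr mulr1 -addrA -opprD addrA.
congr (1 - _); apply/eqP; rewrite subr_eq; apply/eqP.
by rewrite {1 2}yE -scalerDl -rmorphD /= -mulr2n -(mulr_natl 2^-1) divff// scale1r.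
Qed.

End Convergence.

Lemma qlim_intertwine k m b : rnorm k <= 1 -> rnorm m <= 1 ->
  k * b = b * m -> qlim k * b = b * qlim m.
Proof.
move=> k1 m1 kb; apply: (rnorm_tends_to_uniq (tends_toMr b (qiter_cvg k1))).
have := tends_toMl b (qiter_cvg m1).
by under [X in tends_to _ X]eq_fun do rewrite -(qiter_intertwine _ kb).
Qed.

Lemma star_qlim k : rnorm k <= 1 -> star k = k -> star (qlim k) = qlim k.
Proof.
move=> k1 sk; apply: (rnorm_tends_to_uniq (tends_to_star (qiter_cvg k1))).
under [X in tends_to _ X]eq_fun do rewrite star_qiter sk.
exact: qiter_cvg.
Qed.

End Sqrt.

(** * Positive elements and their square roots *)

Section Positive.
Variables (R : realType) (A : cstarAlgType R).
Implicit Types (a b c h k m r s : A) (t : R).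

Definition ascal t : A := t%:C *: (1 : A).

Lemma ascalMl t a : ascal t * a = t%:C *: a.
Proof. by rewrite -scaleAl mul1r. Qed.
Lemma ascalMr t a : a * ascal t = t%:C *: a.
Proof. by rewrite -scaleAr mulr1. Qed.
Lemma ascalD t t' : ascal (t + t') = ascal t + ascal t'.
Proof. by rewrite /ascal rmorphD scalerDl. Qed.
Lemma ascal0 : ascal 0 = 0.
Proof. by rewrite /ascal scale0r. Qed.
Lemma star_ascal t : star (ascal t) = ascal t.
Proof. by rewrite starZR star1. Qed.
Lemma rnorm_ascal t : 0 <= t -> rnorm (ascal t) <= t.
Proof.
move=> t0; rewrite rnormZ ger0_norm//; have := rnorm1_le A; nra.
Qed.

Lemma scalerRA t t' a : t%:C *: (t'%:C *: a) = (t * t')%:C *: a.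
Proof. by rewrite scalerA -rmorphM. Qed.

Lemma scaleri2 a : 'i *: ('i *: a) = - a.
Proof. by rewrite scalerA -[_ * _]expr2 sqr_i scaleN1r. Qed.

Lemma addrr_half a : (2^-1)%:C *: (a + a) = a.
Proof.
rewrite scalerDr -scalerDl.
have -> : (2^-1)%:C + (2^-1)%:C = 1 :> R[i].
  by apply/eqP; rewrite eq_complex /= addr0 eqxx andbT; apply/eqP; field.
by rewrite scale1r.
Qed.

Lemma sa_sqr0 s : star s = s -> s * s = 0 -> s = 0.
Proof.
move=> ss s0; apply: rnorm_le0.
by have := rnorm_sqr_sa ss; rewrite s0 rnorm0; have := rnorm_ge0 s; nra.
Qed.

(* [r + i s] has norm at most [sqrt t], and [r] is its real part. *)
Lemma rnorm_circle r s t : star r = r -> star s = s -> r * s = s * r ->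
  0 <= t -> r * r + s * s = ascal t -> rnorm (r * r) <= t.
Proof.
move=> sr ss rs t0 rst; set u := r + 'i *: s.
have su : star u = r - 'i *: s by rewrite starDr starZi sr ss.
have uu : star u * u = ascal t.
  rewrite su mulrBl !mulrDr -scaleAr -!scaleAl -scaleAr rs opprD addrA addrK.
  by rewrite scaleri2 opprK.
have nu : rnorm u ^+ 2 <= t by rewrite -rnorm_starM uu rnorm_ascal.
have ru : rnorm r <= rnorm u.
  have -> : r = (2^-1)%:C *: (u + star u).
    by rewrite su /u addrACA subrr addr0 addrr_half.
  rewrite rnormZ_half; have := rnormD u (star u); rewrite rnorm_star.
  lra.
rewrite rnorm_sqr_sa//; have := rnorm_ge0 r; nra.
Qed.

(** For self-adjoint [a], the norm condition places the spectrum in [[0, 2 t]]. *)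
Definition pos a : Prop :=
  star a = a /\ exists2 t, 0 <= t & rnorm (ascal t - a) <= t.

(** Writes [h = t (1 - k)] with [k = 1 - t^-1 h], which has norm at most 1 when [|t - h| <= t].
    Keeping [t] explicit lets one bound serve two intertwined elements. *)
Definition psqrt t h : A :=
  (Num.sqrt t)%:C *: (1 - qlim (1 - (t^-1)%:C *: h)).

Section Psqrt.
Variable t : R.
Hypothesis t_gt0 : 0 < t.

Lemma psqrt_aux h : rnorm (ascal t - h) <= t -> rnorm (1 - (t^-1)%:C *: h) <= 1.
Proof.
move=> ht; have -> : 1 - (t^-1)%:C *: h = (t^-1)%:C *: (ascal t - h).
  by rewrite scalerBr scalerRA mulVf ?gt_eqF// scale1r.
by rewrite rnormZ ger0_norm ?invr_ge0 ?(ltW t_gt0)// mulrC ler_pdivrMr// mul1r.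
Qed.

Lemma psqrt_sqr h : rnorm (ascal t - h) <= t -> psqrt t h * psqrt t h = h.
Proof.
move=> /psqrt_aux ht; rewrite -scaleAl -scaleAr scalerRA -expr2 sqr_sqrtr ?ltW//.
by rewrite sqr_1Bqlim// opprB addrC subrK scalerRA mulfV ?gt_eqF// scale1r.
Qed.

Lemma psqrt_intertwine h k b : rnorm (ascal t - h) <= t ->
  rnorm (ascal t - k) <= t -> h * b = b * k -> psqrt t h * b = b * psqrt t k.
Proof.
move=> ht kt hb; rewrite -scaleAl -scaleAr; congr (_ *: _).
rewrite mulrBl mulrBr mul1r mulr1; congr (_ - _).
apply: qlim_intertwine; rewrite ?psqrt_aux//.
by rewrite mulrBl mulrBr mul1r mulr1 -scaleAl -scaleAr hb.
Qed.

Lemma star_psqrt h : star h = h -> rnorm (ascal t - h) <= t ->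
  star (psqrt t h) = psqrt t h.
Proof.
move=> sh ht; rewrite starZR starB star1 star_qlim ?psqrt_aux//.
by rewrite starB star1 starZR sh.
Qed.

Lemma pos_psqrt h : star h = h -> rnorm (ascal t - h) <= t -> pos (psqrt t h).
Proof.
move=> sh ht; split; first exact: star_psqrt.
exists (Num.sqrt t); first exact: sqrtr_ge0.
rewrite /ascal /psqrt -scalerBr opprB addrC subrK rnormZ ger0_norm ?sqrtr_ge0//.
by apply: ler_piMr; rewrite ?sqrtr_ge0// rnorm_qlim// psqrt_aux.
Qed.

End Psqrt.

(** [h = t - s * s] meets the premise of [psqrt], so it has a self-adjoint root commuting with [s];
    the squares of this root and of [s] add up to [t], and [rnorm_circle] bounds [h]. *)
Lemma rnorm_ascalB_sqr s t : star s = s -> rnorm (s * s) <= t ->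
  rnorm (ascal t - s * s) <= t.
Proof.
move=> ss st.
have := le_trans (rnorm_ge0 _) st; rewrite le_eqVlt => /orP[/eqP t0|t0].
  by move: st; rewrite -t0 ascal0 => /rnorm_le0 ->; rewrite subrr rnorm0.
set h := ascal t - s * s.
have ht : rnorm (ascal t - h) <= t by rewrite /h opprB addrC subrK.
have sh : star h = h by rewrite starB star_ascal starMr ss.
have hs : h * s = s * h by rewrite mulrBl mulrBr ascalMl ascalMr mulrA.
rewrite -(psqrt_sqr t0 ht); apply: (@rnorm_circle _ s) => //.
- exact: star_psqrt.
- exact: psqrt_intertwine.
- exact: ltW.
- by rewrite psqrt_sqr// subrK.
Qed.

Lemma pos_sqr s : star s = s -> pos (s * s).
Proof.
move=> ss; split; first by rewrite starMr ss.
by exists (rnorm (s * s)); [exact: rnorm_ge0|exact: rnorm_ascalB_sqr].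
Qed.

Lemma pos_sqrt a : pos a -> exists s,
  [/\ star s = s, pos s, s * s = a & forall b, a * b = b * a -> s * b = b * s].
Proof.
move=> [sa [t t0 at_]].
(* [psqrt] requires a positive bound, while [t] may be 0. *)
have t1 : 0 < t + 1 by rewrite ltr_wpDl.
have at1 : rnorm (ascal (t + 1) - a) <= t + 1.
  rewrite ascalD addrAC; apply: (le_trans (rnormD _ _)).
  by apply: lerD => //; exact: rnorm_ascal.
exists (psqrt (t + 1) a); split.
- exact: star_psqrt.
- exact: pos_psqrt.
- exact: psqrt_sqr.
- by move=> b ab; exact: psqrt_intertwine.
Qed.

Lemma pos_sa a : pos a -> star a = a. Proof. by case. Qed.

Lemma rnorm_ascalB_pos a t : pos a -> rnorm a <= t -> rnorm (ascal t - a) <= t.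
Proof. by move=> /pos_sqrt[s [ss _ <- _]]; exact: rnorm_ascalB_sqr. Qed.

Lemma pos_ascalB a t : star a = a -> rnorm a <= t -> pos (ascal t - a).
Proof.
move=> sa at_; split; first by rewrite starB star_ascal sa.
exists t; first exact: le_trans (rnorm_ge0 _) at_.
by rewrite opprB addrC subrK.
Qed.

Lemma posD a b : pos a -> pos b -> pos (a + b).
Proof.
move=> [sa [t t0 ta]] [sb [u u0 ub]]; split; first by rewrite starDr sa sb.
exists (t + u); first exact: addr_ge0.
rewrite ascalD opprD addrACA; apply: (le_trans (rnormD _ _)).
exact: lerD.
Qed.

Lemma posZ t a : 0 <= t -> pos a -> pos (t%:C *: a).
Proof.
move=> t0 [sa [u u0 ua]]; split; first by rewrite starZR sa.
exists (t * u); first exact: mulr_ge0.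
rewrite -[ascal _]scalerRA -scalerBr rnormZ ger0_norm//.
exact: ler_wpM2l.
Qed.

Lemma pos0 : pos 0.
Proof.
by split; [exact: star0|exists 0; rewrite ?ascal0 ?subrr ?rnorm0].
Qed.

Lemma pos_ascal t : 0 <= t -> pos (ascal t).
Proof.
by move=> t0; split; [exact: star_ascal|exists t; rewrite ?subrr ?rnorm0].
Qed.

(** The roots of [a] and of [t - a] commute and their squares add up to [t], so [rnorm_circle]
    applies. *)
Lemma pos_ascal_le a t : 0 <= t -> pos a -> pos (ascal t - a) -> rnorm a <= t.
Proof.
move=> t0 /pos_sqrt[s [ss _ sa sc]] /pos_sqrt[r [sr _ ra rc]].
rewrite -sa; apply: (@rnorm_circle _ r) => //; last by rewrite sa ra addrC subrK.
apply: sc; apply/esym/rc.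
by rewrite mulrBl mulrBr ascalMl ascalMr.
Qed.

Lemma pos_le a b : pos a -> pos (b - a) -> rnorm a <= rnorm b.
Proof.
move=> pa pab; apply: pos_ascal_le => //; first exact: rnorm_ge0.
have -> : ascal (rnorm b) - a = (ascal (rnorm b) - b) + (b - a).
  by rewrite addrA subrK.
apply: posD => //; apply: pos_ascalB => //.
by rewrite -[b](subrK a) starDr (pos_sa pa) (pos_sa pab).
Qed.

Lemma pos_eq0 a : pos a -> pos (- a) -> a = 0.
Proof.
by move=> pa pNa; apply: rnorm_le0; rewrite -(rnorm0 A) pos_le// sub0r.
Qed.

Lemma posM a b : pos a -> pos b -> a * b = b * a -> pos (a * b).
Proof.
move=> /pos_sqrt[s [ss _ <- sc]] /pos_sqrt[r [sr _ <- rc]] ab.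
have srr : s * (r * r) = r * r * s by exact: sc.
have rs : r * s = s * r by apply: rc.
have -> : s * s * (r * r) = (s * r) * (s * r).
  by rewrite !mulrA -(mulrA s r s) rs mulrA.
by apply: pos_sqr; rewrite starMr ss sr rs.
Qed.

(** The bound [rnorm a + 1] eventually dominates the norms of the [u n], so a single [t] tests
    positivity along the sequence and passes to the limit. *)
Lemma pos_closed u a : (forall n, pos (u n)) -> tends_to (@rnorm R A) u a -> pos a.
Proof.
move=> pu ua.
have sa : star a = a.
  apply: (rnorm_tends_to_uniq (tends_to_star ua)).
  by under [X in tends_to _ X]eq_fun do rewrite (pos_sa (pu _)).
split => //; exists (rnorm a + 1); first by rewrite addr_ge0// rnorm_ge0.
have [n0 Hn0] := ua 1 ltr01.
apply: (tends_to_bound (u := fun n => ascal (rnorm a + 1) - u n) (n1 := n0)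
  (rnorm_group A)) => [e /ua[n1 Hn1]|n /Hn0 Hn].
  exists n1 => n /Hn1; set x := ascal _.
  by rewrite -(rnormN (u n - a)) !opprB (addrC (x - _)) subrKA.
apply: rnorm_ascalB_pos => //.
have := rnormD (u n - a) a; rewrite subrK; lra.
Qed.

(** The difference [d] of the two roots commutes with both, and [d * (q + k) = 0]. Hence the
    positive elements [d * d * q] and [d * d * k] have sum 0 and both vanish, which gives
    [d * d * d = 0] and then [d = 0]. *)
Lemma psqrt_uniq t k : 0 < t -> pos k -> rnorm (k * k) <= t ->
  psqrt t (k * k) = k.
Proof.
move=> t0 pk kt; have sk := pos_sa pk.
have ht := rnorm_ascalB_sqr sk kt.
have skk : star (k * k) = k * k by rewrite starMr sk.
have pq := pos_psqrt t0 skk ht.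
have qq := psqrt_sqr t0 ht.
have qk : psqrt t (k * k) * k = k * psqrt t (k * k).
  by apply: psqrt_intertwine => //; rewrite mulrA.
set q := psqrt _ _ in pq qq qk *.
apply/subr0_eq; set d := q - k.
have sd : star d = d by rewrite starB sk (pos_sa pq).
have dq : d * q = q * d by rewrite mulrBl mulrBr qk.
have dk : d * k = k * d by rewrite mulrBl mulrBr qk.
have d0 : d * (q + k) = 0.
  by rewrite mulrDr !mulrBl qk addrA subrK qq subrr.
have pdq : pos (d * d * q).
  by apply: posM => //; [exact: pos_sqr|rewrite -mulrA dq !mulrA dq].
have pdk : pos (d * d * k).
  by apply: posM => //; [exact: pos_sqr|rewrite -mulrA dk !mulrA dk].
have sum0 : d * d * q + d * d * k = 0 by rewrite -mulrDr -mulrA d0 mulr0.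
have dq0 : d * d * q = 0.
  by apply: pos_eq0 => //; move/eqP: sum0; rewrite addr_eq0 => /eqP ->; rewrite opprK.
have dk0 : d * d * k = 0 by rewrite -sum0 dq0 add0r.
have ddd : d * d * d = 0 by rewrite [LHS]mulrBr dq0 dk0 subrr.
apply: sa_sqr0 => //; apply: sa_sqr0; first by rewrite starMr sd.
by rewrite mulrA ddd mul0r.
Qed.

(** Up to sign, [c] and [d] are twice the real and imaginary parts of [a], and the sum is half of
    [c * c + d * d]. *)
Lemma pos_sum_star a : pos (star a * a + a * star a).
Proof.
set c := a + star a; set d := 'i *: (a - star a).
have sc : star c = c by rewrite starDr starK addrC.
have sd : star d = d by rewrite starZi starB starK -scalerN opprB.
have expand (x y z w : A) :
    (z + y) + (z + y) = x + y + (z + w) + (- x + y + (z - w)).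
  rewrite [RHS]addrACA (_ : x + y + _ = y + y); last first.
    by rewrite (addrC x) addrA addrK.
  rewrite (_ : z + w + _ = z + z); last by rewrite addrACA subrr addr0.
  by rewrite [RHS]addrC addrACA.
have -> : star a * a + a * star a = (2^-1)%:C *: (c * c + d * d).
  rewrite -[LHS]addrr_half; congr (_ *: _).
  rewrite -scaleAl -scaleAr scaleri2 /c; set b := star a.
  by rewrite !mulrDl !mulrDr !mulNr !mulrN !opprD !opprK.
apply: posZ; first by rewrite invr_ge0.
by apply: posD; exact: pos_sqr.
Qed.

(* The intertwining relation [(b b^* ) b = b (b^* b)] passes to absolute values,
   where [|b b^*| = b b^*] but [|b^* b| = - b^* b]. *)
Lemma star_self_neg b : pos (- (star b * b)) -> b = 0.
Proof.
move=> pm; set m := star b * b in pm; set k := b * star b.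
have pk : pos k.
  have := posD (pos_sum_star b) pm.
  by rewrite -/m -/k addrAC subrr add0r.
set t := rnorm (k * k) + rnorm ((- m) * (- m)) + 1.
have k0 := rnorm_ge0 (k * k); have m0 := rnorm_ge0 ((- m) * (- m)).
have t0 : 0 < t by rewrite /t; lra.
have kt : rnorm (k * k) <= t by rewrite /t; lra.
have mt : rnorm ((- m) * (- m)) <= t by rewrite /t; lra.
have kb : k * b = b * m by rewrite /k /m mulrA.
have : psqrt t (k * k) * b = b * psqrt t ((- m) * (- m)).
  apply: psqrt_intertwine => //.
  - by apply: rnorm_ascalB_sqr => //; exact: pos_sa.
  - by apply: rnorm_ascalB_sqr => //; exact: pos_sa.
  - by rewrite mulrNN -mulrA kb (mulrA k) kb (mulrA b m).
rewrite !psqrt_uniq// mulrN -kb => /eqP.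
rewrite -addr_eq0 => /eqP kb0.
have {}kb0 : k * b = 0.
  by rewrite -(addrr_half (k * b)) kb0 scaler0.
have mm0 : m = 0.
  apply: sa_sqr0; first by rewrite /m starMr starK.
  by rewrite {1}/m -mulrA -kb kb0 mulr0.
apply: rnorm_le0; have := rnorm_starM b; rewrite -/m mm0 rnorm0.
have := rnorm_ge0 b; nra.
Qed.

(** Let [q] be the absolute value of [h] and [v = q - h], twice the negative part of [h]. Then
    [star (a * v) * (a * v)] is the negative of a positive element, so [a * v = 0] by
    [star_self_neg]. Hence [h * v = 0], then [v = 0] and [h = q]. *)
Lemma pos_star_self a : pos (star a * a).
Proof.
set h := star a * a.
have sh : star h = h by rewrite starMr starK.
set t := rnorm (h * h) + 1.
have t0 : 0 < t by rewrite ltr_wpDl// rnorm_ge0.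
have ht : rnorm (ascal t - h * h) <= t by apply: rnorm_ascalB_sqr => //; rewrite lerDl.
have shh : star (h * h) = h * h by rewrite starMr sh.
have pq := pos_psqrt t0 shh ht; have qq := psqrt_sqr t0 ht.
have qh : psqrt t (h * h) * h = h * psqrt t (h * h).
  by apply: psqrt_intertwine => //; rewrite mulrA.
set q := psqrt _ _ in pq qq qh.
set v := q - h.
have sv : star v = v by rewrite starB sh (pos_sa pq).
have qv : q * v = v * q by rewrite mulrBl mulrBr qh.
have hv : h * v = - (q * v) by rewrite !mulrBr -qh -qq opprB.
have vv : v * v = (q * v) + (q * v) by rewrite {1}/v mulrBl hv opprK.
have : a * v = 0.
  apply: star_self_neg; rewrite starMr sv mulrA -(mulrA v) -/h -(mulrA v) hv.
  rewrite mulrN opprK mulrA -qv -mulrA; apply: posM => //; first exact: pos_sqr.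
  by rewrite mulrA qv -mulrA qv mulrA.
move=> av0; have hv0 : h * v = 0 by rewrite /h -mulrA av0 mulr0.
have : v = 0.
  apply: sa_sqr0 => //; rewrite vv.
  by move/eqP: hv; rewrite hv0 eq_sym oppr_eq0 => /eqP ->; rewrite addr0.
by move/subr0_eq => <-.
Qed.

Lemma pos_conj b c : pos c -> pos (star b * c * b).
Proof.
move=> /pos_sqrt[s [ss _ <- _]]; have := pos_star_self (s * b).
by rewrite starMr ss !mulrA.
Qed.

End Positive.

(** * From norm inequalities to inequalities of positive elements *)

Section Comparison.
Variables (R : realType) (A : cstarAlgType R).
Implicit Types (a b c p q s : A) (t e : R).

Lemma pos_addgt0 a : (forall e, 0 < e -> pos (a + ascal A e)) -> pos a.
Proof.
move=> H; apply: (@pos_closed _ _ (fun n => a + ascal A (n.+1%:R^-1))).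
  by move=> n; apply: H; rewrite invr_gt0.
move=> e e0; exists (Num.truncn e^-1) => n n0n.
rewrite addrAC subrr add0r.
apply: le_lt_trans (rnorm_ascal _ _) _; first by rewrite invr_ge0.
rewrite invf_plt ?posrE//; apply: lt_le_trans (truncnS_gt _) _.
by rewrite ler_nat.
Qed.

(** With [T = rnorm q + e], one has [q + e = T (1 - y)] for [y = (rnorm q - q) / T], of norm at most
    [rnorm q / T < 1]; a Neumann series inverts [1 - y]. *)
Lemma pos_shift_inv q e : pos q -> 0 < e -> exists x, (q + ascal A e) * x = 1.
Proof.
move=> pq e0; set T := rnorm q + e.
have q0 := rnorm_ge0 q.
have T0 : 0 < T by rewrite /T; lra.
have TV0 : 0 <= T^-1 by rewrite invr_ge0 ltW.
pose y : A := 1 - (T^-1)%:C *: (q + ascal A e).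
have yE : y = (T^-1)%:C *: (ascal A (rnorm q) - q).
  rewrite /y [1 in LHS](_ : _ = (T^-1)%:C *: ascal A T); last first.
    by rewrite scalerRA mulVf ?gt_eqF// scale1r.
  by rewrite -scalerBr /T ascalD opprD addrACA subrr addr0.
have ny : rnorm y <= rnorm q / T.
  rewrite yE rnormZ ger0_norm// mulrC ler_pM2r ?invr_gt0//.
  exact: rnorm_ascalB_pos.
have qT : 0 <= rnorm q / T < 1.
  by rewrite mulr_ge0// ltr_pdivrMr// mul1r /T; lra.
have [x _] := @neumann_solve R A (@rnorm R A) (rnorm_group A) setT
  (fun x => y * x) (rnorm q / T) (ascal A T^-1) (@rnorm_ge0 _ _) (rnorm0 A)
  (@rnorm_le0 _ _) (@complete_rnorm _ _) (fun _ _ _ _ => I) (fun _ _ _ _ => I)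
  (fun _ _ => I) (fun a b _ _ => mulrBr y a b) qT
  (fun x _ => le_trans (rnormM y x) (ler_wpM2r (rnorm_ge0 x) ny)) I I
  (fun _ _ => I).
rewrite -{1}[x]mul1r -mulrBl opprB addrC subrK => H.
exists x; have := congr1 (fun z => T%:C *: z) H.
by rewrite scaleAl !scalerRA mulfV ?gt_eqF// !scale1r.
Qed.

(* Conjugating by [(q + e)^(-1/2)] reduces to the case [q + e = 1]. *)
Lemma pos_of_rnorm_conj p q : pos p -> pos q ->
  (forall a, rnorm (star a * p * a) <= rnorm (star a * q * a)) -> pos (q - p).
Proof.
move=> pp pq H; apply: pos_addgt0 => e e0.
have [x qx] := pos_shift_inv pq e0.
have pqe : pos (q + ascal A e) by apply: posD => //; exact/pos_ascal/ltW.
have [s [ss ps sq _]] := pos_sqrt pqe.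
(* A right inverse of [s]. Since [s] is self-adjoint, [star w] is a left inverse, so the two
   agree. *)
set w := s * x.
have sw : s * w = 1 by rewrite mulrA sq.
have ws' : star w * s = 1 by rewrite -{1}ss -starMr sw star1.
have wE : star w = w by rewrite -[LHS]mulr1 -sw mulrA ws' mul1r.
have ws : w * s = 1 by rewrite -wE.
clearbody w.
have wqw : w * q * w = 1 - e%:C *: (w * w).
  have : w * (q + ascal A e) * w = 1 by rewrite -sq mulrA ws mul1r sw.
  by rewrite mulrDr mulrDl ascalMr -scaleAl => <-; rewrite addrK.
have nq : rnorm (w * q * w) <= 1.
  apply: pos_ascal_le => //; first by rewrite -{1}wE; exact: pos_conj.
  rewrite wqw opprB addrC /ascal scale1r subrK.
  by apply: posZ; [exact: ltW|exact: pos_sqr].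
have np : rnorm (w * p * w) <= 1.
  by apply: le_trans nq; have := H w; rewrite wE.
have sa_wpw : star (w * p * w) = w * p * w.
  by rewrite !starMr wE (pos_sa pp) mulrA.
(* Conjugating back by [s] turns [1 - w * p * w] into [q + e - p]. *)
have := pos_conj s (pos_ascalB sa_wpw np).
rewrite ss /ascal scale1r mulrBr mulrBl mulr1 sq.
by rewrite !mulrA sw mul1r -mulrA ws mulr1 addrAC.
Qed.

(* [x], [y], [z] stand for the Gram matrix [<u, u>], [<u, v>], [<v, v>], and the
   hypothesis for [0 <= <v - u a, v - u a>]. *)
Lemma gram_cauchy_schwarz x y z : pos x -> pos z ->
  (forall a, pos (z - star y * a - star a * y + star a * x * a)) ->
  rnorm y ^+ 2 <= rnorm x * rnorm z.
Proof.
move=> px pz H.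
(* [t] stands in for [rnorm x], which may vanish, and is sent to it at the end. *)
have key t : 0 < t -> rnorm x <= t -> rnorm y ^+ 2 <= t * rnorm z.
  move=> t0 xt; rewrite -ler_pdivrMl//.
  have tV0 : 0 <= t^-1 by rewrite invr_ge0 ltW.
  rewrite -rnorm_starM -[t^-1]ger0_norm// -rnormZ.
  apply: pos_le; first by apply: posZ; [|exact: pos_star_self].
  (* The minimizer when [x] is the scalar [t]; adding [star a * (t - x) * a] to the premise reduces
     to that case. *)
  set a := (t^-1)%:C *: y.
  have := posD (H a) (pos_conj a (pos_ascalB (pos_sa px) xt)).
  have ta : ascal A t * a = y.
    by rewrite ascalMl scalerRA mulfV ?gt_eqF// scale1r.
  rewrite mulrBr mulrBl -(mulrA _ (ascal A t)) ta addrACA subrr addr0 subrK.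
  by rewrite /a -scaleAr.
apply/ler_addgt0Pr => e e0.
have x0 := rnorm_ge0 x; have z0 := rnorm_ge0 z.
have z1 : 0 < rnorm z + 1 by lra.
have e1 : 0 < e / (rnorm z + 1) by rewrite divr_gt0.
apply: (le_trans (key (rnorm x + e / (rnorm z + 1)) _ _)); [lra|lra|].
rewrite mulrDl lerD2l mulrAC ler_pdivrMr//; nra.
Qed.

End Comparison.

(** * The Hilbert module l2(A) *)

Section PartialInner.
Variables (R : realType) (A : cstarAlgType R).
Implicit Types (x y z : nat -> A) (a : A).

Definition pinner (m n : nat) x y : A := \sum_(m <= i < n) star (x i) * y i.

Lemma pinnerC m n x y : star (pinner m n x y) = pinner m n y x.
Proof.
rewrite /pinner (big_morph _ (@starDr R A) (star0 A)).
by apply: eq_bigr => i _; rewrite starMr starK.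
Qed.

Lemma pinnerDl m n x y z :
  pinner m n (fun i => x i + y i) z = pinner m n x z + pinner m n y z.
Proof. by rewrite -big_split; apply: eq_bigr => i _; rewrite starDr mulrDl. Qed.

Lemma pinnerDr m n x y z :
  pinner m n x (fun i => y i + z i) = pinner m n x y + pinner m n x z.
Proof. by rewrite -big_split; apply: eq_bigr => i _; rewrite mulrDr. Qed.

Lemma pinnerMr m n x y a :
  pinner m n x (fun i => y i * a) = pinner m n x y * a.
Proof. by rewrite /pinner mulr_suml; apply: eq_bigr => i _; rewrite mulrA. Qed.

Lemma pinnerMl m n x y a :
  pinner m n (fun i => x i * a) y = star a * pinner m n x y.
Proof. by rewrite -pinnerC pinnerMr starMr pinnerC. Qed.

Lemma pinner_cat m n p x y : (m <= n <= p)%N ->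
  pinner m p x y = pinner m n x y + pinner n p x y.
Proof. by move=> /andP[mn np]; rewrite /pinner (big_cat_nat mn np). Qed.

Lemma pos_pinner m n x : pos (pinner m n x x).
Proof.
apply: (big_ind (@pos R A)) => [|a b|i _]; [exact: pos0|exact: posD|].
exact: pos_star_self.
Qed.

Lemma pinner_cauchy_schwarz m n x y :
  rnorm (pinner m n x y) ^+ 2 <=
  rnorm (pinner m n x x) * rnorm (pinner m n y y).
Proof.
apply: gram_cauchy_schwarz => [||a]; [exact: pos_pinner|exact: pos_pinner|].
have := pos_pinner m n (fun i => y i + x i * - a).
rewrite pinnerDl !pinnerDr !pinnerMl !pinnerMr starN !mulNr !mulrN mulrA opprK.
by rewrite pinnerC addrA.
Qed.

Definition pnorm (m n : nat) x : R := Num.sqrt (rnorm (pinner m n x x)).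

Lemma pnorm_ge0 m n x : 0 <= pnorm m n x. Proof. exact: sqrtr_ge0. Qed.

Lemma pnorm_sqr m n x : pnorm m n x ^+ 2 = rnorm (pinner m n x x).
Proof. by rewrite sqr_sqrtr// rnorm_ge0. Qed.

Lemma rnorm_pinner m n x y :
  rnorm (pinner m n x y) <= pnorm m n x * pnorm m n y.
Proof.
rewrite -[leLHS]ger0_norm ?rnorm_ge0// -sqrtr_sqr -sqrtrM ?rnorm_ge0//.
exact/ler_wsqrtr/pinner_cauchy_schwarz.
Qed.

Lemma pnormD m n x y :
  pnorm m n (fun i => x i + y i) <= pnorm m n x + pnorm m n y.
Proof.
have h0 := addr_ge0 (pnorm_ge0 m n x) (pnorm_ge0 m n y).
rewrite -[leRHS]ger0_norm// -sqrtr_sqr; apply: ler_wsqrtr.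
rewrite pinnerDl !pinnerDr sqrrD !pnorm_sqr.
have := rnormD (pinner m n x x + pinner m n x y) (pinner m n y x + pinner m n y y).
have := rnormD (pinner m n x x) (pinner m n x y).
have := rnormD (pinner m n y x) (pinner m n y y).
have := rnorm_pinner m n x y; have := rnorm_pinner m n y x.
rewrite (mulrC (pnorm _ _ y)) mulr2n; lra.
Qed.

Lemma pnorm_sub m n p x : (m <= n <= p)%N ->
  pnorm m n x <= pnorm m p x /\ pnorm n p x <= pnorm m p x.
Proof.
move=> /pinner_cat e; rewrite /pnorm (e x x); split; apply: ler_wsqrtr.
  by apply: pos_le; rewrite ?addrK 1?addrAC ?subrr ?add0r; exact: pos_pinner.
by apply: pos_le; rewrite ?addrK; exact: pos_pinner.
Qed.

Lemma tail_series (f : nat -> A) m n : (m <= n)%N ->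
  series f n - series f m = \sum_(m <= i < n) f i.
Proof.
move=> mn; rewrite /series /= (big_cat_nat (leq0n m) mn) /=.
by rewrite addrAC subrr add0r.
Qed.

Lemma cvg_series_tail (f : nat -> A) :
  cvgn (series f) <->
  forall e, 0 < e -> exists n0, forall m n, (n0 <= m <= n)%N ->
    rnorm (\sum_(m <= i < n) f i) < e.
Proof.
split=> [/cvg_ex[l /tends_to_cvg fl] e e0|H].
  have [n0 Hn0] := tends_to_cauchy (rnorm_group A) fl e0.
  exists n0 => m n /andP[n0m mn]; rewrite -tail_series//.
  by apply: Hn0 => //; exact: leq_trans mn.
have [e e0|l fl] := @complete_rnorm _ _ (series f).
  have [n0 Hn0] := H e e0; exists n0 => m n n0m n0n.
  have [mn|/ltnW nm] := leqP m n.
    rewrite (gnormB_sym (rnorm_group A)) tail_series// Hn0// n0m//.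
  by rewrite tail_series// Hn0// n0n.
by apply/cvg_ex; exists l; apply/tends_to_cvg.
Qed.

Lemma l2_tail x : cvgn (series (fun i => star (x i) * x i)) <->
  forall e, 0 < e -> exists n0, forall m n, (n0 <= m <= n)%N ->
    pnorm m n x < e.
Proof.
split=> [/cvg_series_tail H e e0|H].
  have [n0 Hn0] := H (e ^+ 2) ltac:(by rewrite exprn_gt0).
  exists n0 => m n /Hn0; rewrite -/(pinner m n x x) -pnorm_sqr.
  by rewrite ltr_pXn2r// nnegrE ?pnorm_ge0// ltW.
apply/cvg_series_tail => e e0.
have [n0 Hn0] := H (Num.sqrt e) ltac:(by rewrite sqrtr_gt0).
exists n0 => m n /Hn0 h; rewrite -/(pinner m n x x) -pnorm_sqr.
rewrite -(sqr_sqrtr (ltW e0)) ltr_pXn2r// nnegrE ?pnorm_ge0// sqrtr_ge0//.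
Qed.

(** Cauchy-Schwarz on blocks makes the tails small, so [inner] is a true limit here and not the
    default value of [limn]. *)
Lemma inner_tends_to (x y : l2 A) :
  tends_to (@rnorm R A) (fun n => pinner 0 n x y) (inner x y).
Proof.
apply/tends_to_cvg; apply: (@cvgP _ (series (fun i => star (x i) * y i) @ \oo)).
apply/cvg_series_tail => e e0.
have /l2_tail Hx := @l2P R A x; have /l2_tail Hy := @l2P R A y.
have [n0 Hn0] := Hx 1 ltr01; have [n1 Hn1] := Hy e e0.
exists (maxn n0 n1) => m n; rewrite geq_max -andbA => /and3P[h0 h1 mn].
apply: (le_lt_trans (rnorm_pinner m n x y)).
have := Hn0 m n ltac:(by rewrite h0); have := Hn1 m n ltac:(by rewrite h1).
have := pnorm_ge0 m n x; have := pnorm_ge0 m n y; nra.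
Qed.

End PartialInner.

Section L2Operations.
Variables (R : realType) (A : cstarAlgType R).
Implicit Types (x y z : l2 A) (a : A) (t : R).

Lemma l2_eq x y : (forall i, x i = y i) -> x = y.
Proof.
case: x y => [x hx] [y hy] /= /funext xy; rewrite {}xy in hx *.
by congr L2; exact: Prop_irrelevance.
Qed.

Lemma l2D_subproof x y :
  cvgn (series (fun i => star (x i + y i) * (x i + y i))).
Proof.
apply/l2_tail => e e0.
have /l2_tail Hx := @l2P R A x; have /l2_tail Hy := @l2P R A y.
have e2 : 0 < e / 2 by lra.
have [n0 Hn0] := Hx _ e2; have [n1 Hn1] := Hy _ e2.
exists (maxn n0 n1) => m n; rewrite geq_max -andbA => /and3P[h0 h1 mn].
have := pnormD m n x y.
have := Hn0 m n ltac:(by rewrite h0); have := Hn1 m n ltac:(by rewrite h1); lra.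
Qed.

Lemma l2N_subproof x : cvgn (series (fun i => star (- x i) * (- x i))).
Proof.
rewrite (_ : (fun i => _) = (fun i => star (x i) * x i)); first exact: l2P.
by apply/funext => i; rewrite starN mulrNN.
Qed.

Lemma l20_subproof : cvgn (series (fun i : nat => star (0 : A) * (0 : A))).
Proof.
apply/cvg_series_tail => e e0; exists 0 => m n _.
by rewrite big1 ?rnorm0// => i _; rewrite mulr0.
Qed.

Lemma l2M_subproof x a : cvgn (series (fun i => star (x i * a) * (x i * a))).
Proof.
apply/cvg_ex; exists (star a * inner x x * a); apply/tends_to_cvg.
have := tends_toMr a (tends_toMl (star a) (inner_tends_to x x)).
by under [X in tends_to _ X]eq_fun do rewrite -pinnerMl -pinnerMr.
Qed.

Definition l2zero := L2 (@l20_subproof).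
Definition l2add x y := L2 (@l2D_subproof x y).
Definition l2opp x := L2 (@l2N_subproof x).
(** The right action of [A]; real scalars act as [ract _ (ascal A t)]. *)
Definition ract x a := L2 (@l2M_subproof x a).

End L2Operations.

HB.instance Definition _ (R : realType) (A : cstarAlgType R) :=
  gen_eqMixin (l2 A).
HB.instance Definition _ (R : realType) (A : cstarAlgType R) :=
  gen_choiceMixin (l2 A).

Section L2Zmodule.
Variables (R : realType) (A : cstarAlgType R).

Lemma l2addA : associative (@l2add R A).
Proof. by move=> x y z; apply: l2_eq => i /=; rewrite addrA. Qed.
Lemma l2addC : commutative (@l2add R A).
Proof. by move=> x y; apply: l2_eq => i /=; rewrite addrC. Qed.
Lemma l2add0 : left_id (@l2zero R A) (@l2add R A).
Proof. by move=> x; apply: l2_eq => i /=; rewrite add0r. Qed.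
Lemma l2addN : left_inverse (@l2zero R A) (@l2opp R A) (@l2add R A).
Proof. by move=> x; apply: l2_eq => i /=; rewrite addNr. Qed.

End L2Zmodule.

HB.instance Definition _ (R : realType) (A : cstarAlgType R) :=
  GRing.isZmodule.Build (l2 A)
    (@l2addA R A) (@l2addC R A) (@l2add0 R A) (@l2addN R A).

Section L2Norm.
Variables (R : realType) (A : cstarAlgType R).
Implicit Types (x y z : l2 A) (a : A) (t : R).

Lemma innerC x y : star (inner x y) = inner y x.
Proof.
apply: (rnorm_tends_to_uniq (tends_to_star (inner_tends_to x y))).
by under [X in tends_to _ X]eq_fun do rewrite pinnerC; exact: inner_tends_to.
Qed.

Lemma innerDr x y z : inner x (y + z) = inner x y + inner x z.
Proof.
apply: (rnorm_tends_to_uniq (inner_tends_to x (y + z))).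
have := tends_toD (rnorm_group A) (inner_tends_to x y) (inner_tends_to x z).
by under [X in tends_to _ X]eq_fun do rewrite -pinnerDr.
Qed.

Lemma innerMr x y a : inner x (ract y a) = inner x y * a.
Proof.
apply: (rnorm_tends_to_uniq (inner_tends_to x (ract y a))).
have := tends_toMr a (inner_tends_to x y).
by under [X in tends_to _ X]eq_fun do rewrite -pinnerMr.
Qed.

Lemma innerDl x y z : inner (x + y) z = inner x z + inner y z.
Proof. by rewrite -innerC innerDr starDr !innerC. Qed.

Lemma innerMl x y a : inner (ract x a) y = star a * inner x y.
Proof. by rewrite -innerC innerMr starMr innerC. Qed.

Lemma inner0r x : inner x (0 : l2 A) = 0.
Proof. by apply: (addrI (inner x (0 : l2 A))); rewrite -innerDr !addr0. Qed.

Lemma innerNr x y : inner x (- y) = - inner x y.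
Proof. by apply: (addrI (inner x y)); rewrite -innerDr !subrr inner0r. Qed.

Lemma innerBr x y z : inner x (y - z) = inner x y - inner x z.
Proof. by rewrite innerDr innerNr. Qed.

Lemma innerNl x y : inner (- x) y = - inner x y.
Proof. by rewrite -innerC innerNr starN innerC. Qed.

Lemma innerBl x y z : inner (x - y) z = inner x z - inner y z.
Proof. by rewrite innerDl innerNl. Qed.

Lemma inner0l x : inner (0 : l2 A) x = 0.
Proof. by rewrite -innerC inner0r star0. Qed.

Lemma pos_inner x : pos (inner x x).
Proof. by apply: (pos_closed _ (inner_tends_to x x)) => n; exact: pos_pinner. Qed.

Lemma pos_inner_tail n x : pos (inner x x - pinner 0 n x x).
Proof.
(* [maxn n m] makes every term a block sum, hence positive, without changing the limit. *)
apply: (@pos_closed _ _ (fun m => pinner 0 (maxn n m) x x - pinner 0 n x x)).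
  move=> m; rewrite (@pinner_cat _ _ 0 n (maxn n m)) ?leq_maxl//.
  by rewrite addrAC subrr add0r; exact: pos_pinner.
move=> e /(inner_tends_to x x)[n0 Hn0]; exists n0 => m n0m.
rewrite opprB addrA subrK; apply: Hn0; exact: leq_trans (leq_maxr _ _).
Qed.

Lemma l2norm_ge0 x : 0 <= l2norm x. Proof. exact: sqrtr_ge0. Qed.

Lemma l2norm_sqr x : l2norm x ^+ 2 = rnorm (inner x x).
Proof. by rewrite sqr_sqrtr// rnorm_ge0. Qed.

Lemma pnorm_le_l2norm n x : pnorm 0 n x <= l2norm x.
Proof.
by apply/ler_wsqrtr/pos_le; [exact: pos_pinner|exact: pos_inner_tail].
Qed.

Lemma l2norm_le_pnorm x t :
  0 <= t -> (forall n, pnorm 0 n x <= t) -> l2norm x <= t.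
Proof.
move=> t0 H; rewrite -(ger0_norm t0) -sqrtr_sqr; apply: ler_wsqrtr.
apply: (tends_to_bound (n1 := 0) (rnorm_group A) (inner_tends_to x x)) => n _.
by rewrite -pnorm_sqr lerXn2r// nnegrE pnorm_ge0.
Qed.

Lemma rnorm_coord x i : rnorm (x i) <= l2norm x.
Proof.
apply: le_trans (pnorm_le_l2norm i.+1 x).
rewrite -[leLHS]ger0_norm ?rnorm_ge0// -sqrtr_sqr -rnorm_starM.
apply/ler_wsqrtr/pos_le; first exact: pos_star_self.
rewrite (@pinner_cat _ _ 0 i i.+1) ?leqnSn// {2}/pinner big_nat1 addrK.
exact: pos_pinner.
Qed.

Lemma l2norm_le0 x : l2norm x <= 0 -> x = 0.
Proof.
move=> x0; apply: l2_eq => i; apply: rnorm_le0.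
exact: le_trans (rnorm_coord x i) x0.
Qed.

Lemma l2norm0 : l2norm (0 : l2 A) = 0.
Proof. by rewrite /l2norm inner0r rnorm0 sqrtr0. Qed.

Lemma inner_eq0 x : inner x x = 0 -> x = 0.
Proof. by move=> x0; apply: l2norm_le0; rewrite /l2norm x0 rnorm0 sqrtr0. Qed.

Lemma inner_ext x y : (forall z, inner z x = inner z y) -> x = y.
Proof.
by move=> H; apply/subr0_eq/inner_eq0; rewrite innerBr H subrr.
Qed.

Lemma cauchy_schwarz x y : rnorm (inner x y) <= l2norm x * l2norm y.
Proof.
apply: (tends_to_bound (n1 := 0) (rnorm_group A) (inner_tends_to x y)) => n _.
apply: (le_trans (rnorm_pinner 0 n x y)).
by apply: ler_pM; rewrite ?pnorm_ge0// pnorm_le_l2norm.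
Qed.

Lemma l2normD x y : l2norm (x + y) <= l2norm x + l2norm y.
Proof.
apply: l2norm_le_pnorm => [|n]; first by rewrite addr_ge0// l2norm_ge0.
apply: (le_trans (pnormD 0 n x y)).
by apply: lerD; exact: pnorm_le_l2norm.
Qed.

Lemma l2normN x : l2norm (- x) = l2norm x.
Proof. by rewrite /l2norm innerNl innerNr opprK. Qed.

Lemma l2norm_group : group_norm (fun x : l2 A => l2norm x).
Proof. by split; [exact: l2normD|exact: l2normN]. Qed.

(** The candidate is the coordinatewise limit [f]. On each finite block [f - u m] tends to 0, so the
    Cauchy bound on [u m - u n] passes to [f - u n] uniformly in the block. This yields both square
    summability of [f] and convergence to it. *)
Lemma complete_l2norm : complete_for (fun x : l2 A => l2norm x).
Proof.
move=> u cu.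
have /choice[f uf] i : exists l, tends_to (@rnorm R A) (fun n => u n i) l.
  apply: complete_rnorm => e /cu[n0 Hn0]; exists n0 => m n n0m n0n.
  exact: le_lt_trans (rnorm_coord (u m - u n) i) (Hn0 _ _ n0m n0n).
have pf0 N : tends_to (@rnorm R A)
    (fun m => pinner 0 N (fun i => f i - u m i) (fun i => f i - u m i)) 0.
  elim: N => [|N IH] e e0.
    by exists 0 => n _; rewrite /pinner big_geq// subrr rnorm0.
  have [n0 Hn0] := IH (e / 2) ltac:(lra).
  have [n1 Hn1] := uf N (Num.sqrt (e / 2)) ltac:(by rewrite sqrtr_gt0; lra).
  exists (maxn n0 n1) => n; rewrite geq_max => /andP[/Hn0 h0 /Hn1 h1].
  move: h0; rewrite !subr0 (@pinner_cat _ _ 0 N N.+1) ?leqnSn// => h0.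
  apply: (le_lt_trans (rnormD _ _)).
  rewrite {2}/pinner big_nat1 rnorm_starM (gnormB_sym (rnorm_group A)).
  have : rnorm (u n N - f N) ^+ 2 < e / 2.
    rewrite -(@sqr_sqrtr _ (e / 2)); last lra.
    by rewrite ltr_pXn2r// nnegrE ?rnorm_ge0 ?sqrtr_ge0.
  lra.
have pfu e : 0 < e -> exists n0, forall n, (n0 <= n)%N ->
    forall N, pnorm 0 N (fun i => f i - u n i) <= e.
  move=> e0; have [n0 Hn0] := cu e e0; exists n0 => n n0n N.
  apply/ler_addgt0Pr => d d0.
  have [m0 Hm0] := pf0 N (d ^+ 2) ltac:(by rewrite exprn_gt0).
  set m := maxn m0 n0.
  have := Hm0 m (leq_maxl _ _); rewrite subr0 -pnorm_sqr.
  rewrite ltr_pXn2r ?nnegrE ?pnorm_ge0 ?(ltW d0)// => h1.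
  have h2 := Hn0 m n (leq_maxr _ _) n0n.
  have h3 := pnorm_le_l2norm N (u m - u n).
  have := pnormD 0 N (fun i => f i - u m i) (u m - u n).
  rewrite (_ : (fun i => _) = (fun i => f i - u n i)); first lra.
  by apply/funext => i /=; rewrite addrA subrK.
have fl2 : cvgn (series (fun i => star (f i) * f i)).
  apply/l2_tail => e e0; have [k Hk] := pfu (e / 2 / 2) ltac:(lra).
  have /l2_tail Hu := @l2P R A (u k).
  have [n0 Hn0] := Hu (e / 2) ltac:(lra).
  exists n0 => m n n0mn; have h1 := Hn0 m n n0mn.
  have /andP[_ mn] := n0mn.
  have [_ h2] := @pnorm_sub _ _ 0 m n (fun i => f i - u k i) mn.
  have h3 := Hk k (leqnn k) n.
  have := pnormD m n (fun i => f i - u k i) (u k).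
  rewrite (_ : (fun i => _) = f); first lra.
  by apply/funext => i; rewrite subrK.
exists (L2 fl2) => e e0; have [n0 Hn0] := pfu (e / 2) ltac:(lra).
exists n0 => n n0n.
rewrite (gnormB_sym l2norm_group).
have : l2norm (L2 fl2 - u n) <= e / 2.
  by apply: l2norm_le_pnorm => [|N]; [lra|exact: Hn0].
lra.
Qed.

Lemma l2norm_scale x t : l2norm (ract x (ascal A t)) = `|t| * l2norm x.
Proof.
rewrite /l2norm innerMl innerMr star_ascal ascalMl ascalMr !rnormZ mulrA.
by rewrite sqrtrM ?mulr_ge0// -expr2 sqrtr_sqr normr_id.
Qed.

End L2Norm.

(** * Adjointable operators with closed range *)

Section Submodules.
Variables (R : realType) (A : cstarAlgType R).
Implicit Types (x y z w : l2 A) (a : A) (t : R) (X Y : set (l2 A)).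

Definition submodule X : Prop :=
  [/\ X 0, forall x y, X x -> X y -> X (x + y) &
      forall x a, X x -> X (ract x a)].

Lemma ractN1 x : ract x (- 1) = - x.
Proof. by apply: l2_eq => i /=; rewrite mulrN mulr1. Qed.

Lemma submoduleN X x : submodule X -> X x -> X (- x).
Proof. by move=> [_ _ XM] /(XM _ (- 1)); rewrite ractN1. Qed.

Lemma submoduleB X x y : submodule X -> X x -> X y -> X (x - y).
Proof. by move=> sX Xx /(submoduleN sX); case: sX => _ XD _; exact: XD. Qed.

Lemma submoduleI X Y : submodule X -> submodule Y -> submodule (X `&` Y).
Proof.
move=> [X0 XD XM] [Y0 YD YM]; split=> // [x y [? ?] [? ?]|x a [? ?]].
  by split; [exact: XD|exact: YD].
by split; [exact: XM|exact: YM].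
Qed.

Lemma submoduleT : submodule (setT : set (l2 A)).
Proof. by []. Qed.

Lemma ractK t x : t != 0 -> ract (ract x (ascal A t)) (ascal A t^-1) = x.
Proof.
move=> t0; apply: l2_eq => i /=.
by rewrite -mulrA ascalMl scalerRA mulfV// scale1r mulr1.
Qed.

Lemma submodule_orth X : submodule (orth X).
Proof.
split=> [x _|x y ox oy z Xz|x a ox z Xz]; first exact: inner0r.
  by rewrite innerDr ox// oy// addr0.
by rewrite innerMr ox// mul0r.
Qed.

Lemma l2closed_lim X (u : nat -> l2 A) x : l2closed X -> (forall n, X (u n)) ->
  tends_to (fun y : l2 A => l2norm y) u x -> X x.
Proof.
move=> cX Xu ux; apply: cX => e /ux[n0 Hn0]; exists (u n0) => //.
by rewrite (gnormB_sym (@l2norm_group R A)); exact: Hn0.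
Qed.

Lemma adherent_le0 X x (r c : R) : 0 <= c ->
  (forall e : R, 0 < e -> exists2 y : l2 A, X y & l2norm (x - y) < e) ->
  (forall y, X y -> r <= c * l2norm (x - y)) -> r <= 0.
Proof.
move=> c0 ad H; apply/ler_addgt0Pr => e e0; rewrite add0r.
have c1 : 0 < c + 1 by lra.
have [y Xy yx] := ad (e / (c + 1)) ltac:(by rewrite divr_gt0).
apply: (le_trans (H y Xy)).
have := l2norm_ge0 (x - y); move: yx; rewrite ltr_pdivlMr//; nra.
Qed.

Lemma l2closed_orth X : l2closed (orth X).
Proof.
move=> x ad z Xz; apply: rnorm_le0.
apply: (adherent_le0 (l2norm_ge0 z) ad) => y oy.
by have := cauchy_schwarz z (x - y); rewrite innerBr oy// subr0.
Qed.

Lemma l2closedI X Y : l2closed X -> l2closed Y -> l2closed (X `&` Y).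
Proof.
move=> cX cY x ad; split; [apply: cX|apply: cY] => e /ad[y [Xy Yy] yx].
  by exists y.
by exists y.
Qed.

(* A norm inequality valid on a submodule holds along every [x a], which
   upgrades it to an inequality between the [A]-valued inner products. *)
Lemma inner_le_of_l2norm X (S T : l2 A -> l2 A) t : submodule X -> 0 <= t ->
  (forall x a, X x -> S (ract x a) = ract (S x) a) ->
  (forall x a, X x -> T (ract x a) = ract (T x) a) ->
  (forall x, X x -> l2norm (S x) <= t * l2norm (T x)) ->
  forall x, X x ->
    pos ((t ^+ 2)%:C *: inner (T x) (T x) - inner (S x) (S x)).
Proof.
move=> [_ _ XM] t0 SM TM ST x Xx.
apply: pos_of_rnorm_conj; first exact: pos_inner.
  by apply: posZ; [exact: sqr_ge0|exact: pos_inner].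
move=> a; rewrite -scaleAr -scaleAl -!mulrA -!innerMr -!innerMl -SM// -TM//.
rewrite rnormZ ger0_norm ?sqr_ge0// -!l2norm_sqr -exprMn.
rewrite lerXn2r ?nnegrE ?mulr_ge0 ?l2norm_ge0//.
exact/ST/XM.
Qed.

End Submodules.

Section Adjointable.
Variables (R : realType) (A : cstarAlgType R).
Implicit Types (D F G : adjointable A) (x y z w : l2 A) (a : A) (t : R).

Definition is_adjoint F G : Prop := forall x y, inner (F x) y = inner x (G y).

Lemma adjL F x y a : F (x + ract y a) = F x + ract (F y) a.
Proof. by apply: l2_eq => i; exact: adj_linear. Qed.

Lemma ract1 x : ract x 1 = x.
Proof. by apply: l2_eq => i /=; rewrite mulr1. Qed.

Lemma adjD F x y : F (x + y) = F x + F y.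
Proof. by have := adjL F x y 1; rewrite !ract1. Qed.

Lemma adj0 F : F 0 = 0.
Proof. by apply: (addrI (F 0)); rewrite -adjD !addr0. Qed.

Lemma adjM F x a : F (ract x a) = ract (F x) a.
Proof. by have := adjL F 0 x a; rewrite adj0 !add0r. Qed.

Lemma adjN F x : F (- x) = - F x.
Proof. by rewrite -!ractN1 adjM. Qed.

Lemma adjB F x y : F (x - y) = F x - F y.
Proof. by rewrite adjD adjN. Qed.

Lemma adj_bound F : exists2 k, 1 <= k & forall x, l2norm (F x) <= k * l2norm x.
Proof.
have [k Hk] := adj_bounded F.
exists (Num.max 1 k); first by rewrite le_max lexx.
move=> x; apply: (le_trans (Hk x)); apply: ler_wpM2r; first exact: l2norm_ge0.
by rewrite le_max lexx orbT.
Qed.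

(** [adj_exists] only provides a function [g]. It is linear because inner products separate vectors,
    and bounded because [l2norm (g x) ^+ 2] is the norm of [inner (F (g x)) x]. *)
Lemma ex_adjoint F : exists G, is_adjoint F G.
Proof.
have [g fg] := adj_exists F; have [k k1 Hk] := adj_bound F.
have gL x y z a : (forall i, z i = x i + y i * a) ->
    forall i, g z i = g x i + g y i * a.
  move=> zE; have -> : z = x + ract y a by exact: l2_eq.
  move=> i; rewrite -[RHS]/((g x + ract (g y) a) i); congr (l2seq _ i).
  by apply: inner_ext => w; rewrite innerDr innerMr -!fg innerDr innerMr.
have gB : exists k : R, forall x, l2norm (g x) <= k * l2norm x.
  exists k => x.
  have := cauchy_schwarz (F (g x)) x; rewrite fg -l2norm_sqr.
  have := Hk (g x); have := l2norm_ge0 (g x); have := l2norm_ge0 x.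
  rewrite le_eqVlt => x0; rewrite le_eqVlt => /orP[/eqP <- _ _|g0 h1 h2].
    by rewrite mulr_ge0 ?l2norm_ge0//; lra.
  have x0' := l2norm_ge0 x.
  rewrite -(ler_pM2l g0) -expr2; apply: (le_trans h2).
  by rewrite mulrA (mulrC (l2norm (g x))); apply: ler_wpM2r.
have gA : exists f : l2 A -> l2 A, forall x y, inner (g x) y = inner x (f y).
  by exists F => x y; rewrite -innerC -fg innerC.
by exists (Adjointable gL gB gA).
Qed.

Lemma is_adjoint_sym F G : is_adjoint F G -> is_adjoint G F.
Proof. by move=> FG x y; rewrite -innerC -FG innerC. Qed.

Lemma ex_comp D F : exists DF : adjointable A, forall x, DF x = D (F x).
Proof.
have [F' FF'] := ex_adjoint F; have [D' DD'] := ex_adjoint D.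
have [k k1 Hk] := adj_bound F; have [l l1 Hl] := adj_bound D.
have L x y z a : (forall i, z i = x i + y i * a) ->
    forall i, D (F z) i = D (F x) i + D (F y) i * a.
  move=> zE; have -> : z = x + ract y a by exact: l2_eq.
  by move=> i; rewrite adjL adjL.
have B : exists k : R, forall x, l2norm (D (F x)) <= k * l2norm x.
  exists (l * k) => x; apply: (le_trans (Hl _)).
  by rewrite -mulrA; apply: ler_wpM2l (Hk x); lra.
have C : exists f : l2 A -> l2 A,
    forall x y, inner (D (F x)) y = inner x (f y).
  by exists (fun y => F' (D' y)) => x y; rewrite DD' FF'.
by exists (Adjointable L B C).
Qed.

Lemma submodule_range F : submodule (range F).
Proof.
split=> [|_ _ [x _ <-] [y _ <-]|_ a [x _ <-]]; first by exists 0; rewrite ?adj0.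
  by exists (x + y); rewrite ?adjD.
by exists (ract x a); rewrite ?adjM.
Qed.

Lemma kerE F x : ker F x <-> F x = 0.
Proof. by split=> [H|H i]; [exact: l2_eq|rewrite H]. Qed.

Lemma submodule_ker F : submodule (ker F).
Proof.
split=> [|x y /kerE x0 /kerE y0|x a /kerE x0]; apply/kerE; first exact: adj0.
  by rewrite adjD x0 y0 addr0.
by rewrite adjM x0; apply: l2_eq => i /=; rewrite mul0r.
Qed.

Section ClosedRange.
Variables F G : adjointable A.
Hypotheses (FG : is_adjoint F G) (F_closed : l2closed (range F)).

(* Gliding hump.  If [y_n] in the range has norm 1 and [G y_n] is small, a
   series of multiples [+- 3^-n y_n] converges in the range to some [F x] with
   [<y_n, F x> = <G y_n, x>] too large for a fixed [x]. *)
Lemma adjoint_bounded_below : exists2 C, 1 <= C &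
  forall y, range F y -> l2norm y <= C * l2norm (G y).
Proof.
apply: contrapT => nH.
have sF := submodule_range F.
have /choice[y Hy] n : exists y, [/\ range F y, l2norm y = 1 &
    l2norm (G y) <= 3^-1 ^+ n / n.+1%:R].
  set C := n.+1%:R * 3 ^+ n : R.
  have C1 : 1 <= C.
    have h1 : 1 <= n.+1%:R :> R by rewrite ler1n.
    have h2 : 1 <= 3 ^+ n :> R by apply: exprn_ege1; lra.
    by rewrite /C; nra.
  have [y ny] : exists y, ~ (range F y -> l2norm y <= C * l2norm (G y)).
    by apply: contrapT => h; apply: nH; exists C => // y Ry;
      apply: contrapT => ny; apply: h; exists y => /(_ Ry).
  have [Ry {}ny] := (not_implyP _ _).1 ny.
  have {}ny : C * l2norm (G y) < l2norm y by rewrite ltNge; exact/negP.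
  have y0 : 0 < l2norm y.
    by apply: le_lt_trans ny; rewrite mulr_ge0 ?l2norm_ge0//; lra.
  have yV0 : 0 <= (l2norm y)^-1 by rewrite invr_ge0 ltW.
  exists (ract y (ascal A (l2norm y)^-1)); split.
  - by case: sF => _ _; apply.
  - by rewrite l2norm_scale ger0_norm// mulVf// gt_eqF.
  - rewrite adjM l2norm_scale ger0_norm//.
    rewrite ler_pdivrMl// -(ler_pM2l (_ : 0 < C)); last lra.
    apply: (le_trans (ltW ny)); rewrite exprVn -invfM mulrCA.
    by rewrite (mulrC (3 ^+ n)) mulfV ?mulr1// gt_eqF//; lra.
pose hump n := ract (y n) (ascal A (3^-1 ^+ n)).
(* One of the signs must work: the pairings of [y n] with the two candidates differ by an element of
   norm [2 * 3^-1 ^+ n]. *)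
pose step n z := if 3^-1 ^+ n <= rnorm (inner (y n) (z + hump n))
  then z + hump n else z - hump n.
pose z := fix z n : l2 A := if n is n'.+1 then step n' (z n') else 0.
have d0 n : 0 < 3^-1 ^+ n :> R by rewrite exprn_gt0// invr_gt0.
have hump_norm n : l2norm (hump n) = 3^-1 ^+ n.
  by rewrite l2norm_scale ger0_norm ?(ltW (d0 n))//; case: (Hy n) => _ -> _; rewrite mulr1.
have hump_range n : range F (hump n).
  by case: sF => _ _; apply; case: (Hy n).
have zS n : z n.+1 = step n (z n) by [].
have z_range n : range F (z n).
  elim: n => [|n IH] /=; first by case: sF.
  rewrite /step; case: ifP => _; first by case: sF => _ + _; apply.
  exact: (submoduleB sF).
(* Minus the sum of [3^-1 ^+ j] over [j >= n]. *)
pose b n : R := - (3 / 2 * 3^-1 ^+ n).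
have zb n : l2norm (z n.+1 - z n) <= b n.+1 - b n.
  have -> : b n.+1 - b n = 3^-1 ^+ n by rewrite /b exprS; field.
  rewrite zS /step; case: ifP => _; rewrite addrAC subrr add0r ?l2normN;
    by rewrite hump_norm.
have bB n : b n <= 0 by rewrite /b oppr_le0; have := d0 n; lra.
have z_large n : 3^-1 ^+ n <= rnorm (inner (y n) (z n.+1)).
  rewrite zS /step; case: ifP => // /negbT; rewrite -ltNge => small.
  have := rnormD (inner (y n) (z n + hump n)) (- inner (y n) (z n - hump n)).
  rewrite rnormN -innerBr opprD opprK addrACA subrr add0r.
  have : rnorm (inner (y n) (hump n + hump n)) = 2 * 3^-1 ^+ n.
    have := rnormZ_half (inner (y n) (hump n + hump n)).
    rewrite innerDr addrr_half innerMr ascalMr rnormZ ger0_norm ?(ltW (d0 n))//.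
    by rewrite -l2norm_sqr; case: (Hy n) => _ -> _; rewrite expr1n; lra.
  lra.
have [l zl] := complete_l2norm (dominated_cauchy (l2norm_group A) zb bB
  (l2norm0 A) (@l2norm_ge0 R A)).
have [x _ xl] := l2closed_lim F_closed z_range zl.
(* The humps after the [n]-th add up to at most half of [3^-1 ^+ n], so half of the pairing survives
   in the limit; it is also at most [l2norm (G (y n)) * l2norm x]. *)
have key n : n.+1%:R <= 2 * l2norm x.
  have [_ y1 Gy] := Hy n.
  have dist := dominated_lim_dist (l2norm_group A) zb bB (l2norm0 A) n.+1 zl.
  have := cauchy_schwarz (y n) (l - z n.+1); rewrite y1 mul1r => cs.
  have := cauchy_schwarz (G (y n)) x; rewrite (is_adjoint_sym FG) xl => cs2.
  have tri := rnormD (inner (y n) l) (- inner (y n) (l - z n.+1)).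
  rewrite -innerBr opprB addrC subrK rnormN in tri.
  have zn := z_large n.
  have h1 : 2^-1 * 3^-1 ^+ n <= rnorm (inner (y n) l).
    move: dist; rewrite /b sub0r opprK exprS; lra.
  have h2 : 2^-1 * 3^-1 ^+ n <= 3^-1 ^+ n / n.+1%:R * l2norm x.
    apply: (le_trans h1); apply: (le_trans cs2).
    by apply: ler_wpM2r => //; exact: l2norm_ge0.
  have n0 : 0 < n.+1%:R :> R by [].
  move: h2 (d0 n); rewrite mulrAC ler_pdivlMr//; nra.
have := key (Num.truncn (2 * l2norm x)).
by rewrite leNgt truncnS_gt.
Qed.

(** For [T = t F G] with [t = k^-2], the bound on [F] gives [<T w, T w> <= t <G w, G w>], and the
    lower bound on [G] gives [s <w, w> <= t <G w, G w>] on the range. Expanding [<w - T w, w - T w>]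
    shows that [1 - T] is a strict contraction there, and a Neumann series solves [T w = t z]. *)
Lemma range_adjoint_onto z : range F z -> exists2 w, range F w & F (G w) = z.
Proof.
have [C C1 GC] := adjoint_bounded_below; have [k k1 Fk] := adj_bound F.
have sF := submodule_range F.
pose t : R := (k ^+ 2)^-1; pose s : R := t * (C ^+ 2)^-1.
have k2 : 1 <= k ^+ 2 by nra.
have C2 : 1 <= C ^+ 2 by nra.
have t0 : 0 < t by rewrite invr_gt0; lra.
have t1 : t <= 1 by rewrite invf_le1//; lra.
have s0 : 0 < s by rewrite mulr_gt0// invr_gt0; lra.
have s1 : s <= 1.
  have : (C ^+ 2)^-1 <= 1 by rewrite invf_le1//; lra.
  have : 0 <= (C ^+ 2)^-1 by rewrite invr_ge0; lra.
  rewrite /s; nra.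
pose T w := ract (F (G w)) (ascal A t).
have TM w a : T (ract w a) = ract (T w) a.
  rewrite /T !adjM; apply: l2_eq => i /=.
  by rewrite -!mulrA ascalMl ascalMr.
have TB x y : T (x - y) = T x - T y.
  by rewrite /T !adjB; apply: l2_eq => i /=; rewrite mulrBl.
have contr w : range F w -> l2norm (w - T w) <= Num.sqrt (1 - s) * l2norm w.
  move=> Rw.
  have h1 : pos (t%:C *: inner (G w) (G w) - inner (T w) (T w)).
    have := inner_le_of_l2norm (@submoduleT R A) (ltac:(lra) : 0 <= k)
      (fun x a _ => adjM F x a) (fun x a _ => erefl) (fun x _ => Fk x) (I : setT (G w)).
    move=> /(posZ (ltac:(nra) : 0 <= t * t)).
    rewrite scalerBr scalerRA -mulrA mulVf ?mulr1; last by rewrite gt_eqF//; lra.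
    by rewrite innerMl innerMr star_ascal ascalMl ascalMr scalerRA.
  have h2 : pos (t%:C *: inner (G w) (G w) - s%:C *: inner w w).
    have := inner_le_of_l2norm sF (ltac:(lra) : 0 <= C)
      (fun x a _ => erefl) (fun x a _ => adjM G x a) GC Rw.
    move=> /(posZ (ltW s0)); rewrite scalerBr scalerRA -mulrA mulVf ?mulr1//.
    by rewrite gt_eqF//; lra.
  have wT : inner w (T w) = t%:C *: inner (G w) (G w).
    by rewrite innerMr ascalMr -(is_adjoint_sym FG).
  have Tw : inner (T w) w = t%:C *: inner (G w) (G w).
    by rewrite -innerC wT starZR innerC.
  rewrite {2}/l2norm -sqrtrM; last lra.
  apply: ler_wsqrtr; rewrite -[1 - s]ger0_norm; last lra.
  rewrite -rnormZ; apply: pos_le; first exact: pos_inner.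
  rewrite innerBl !innerBr wT Tw rmorphB scalerBl scale1r.
  rewrite [X in pos X](_ : _ = (t%:C *: inner (G w) (G w) - s%:C *: inner w w) +
    (t%:C *: inner (G w) (G w) - inner (T w) (T w))); first exact: posD.
  by rewrite !opprB addrC -addrA subrKA addrC.
move=> Rz.
have RM x a : range F x -> range F (ract x a) by case: sF => _ _; apply.
have [] := @neumann_solve R (l2 A) (fun x => l2norm x) (@l2norm_group R A)
  (range F) (fun w => w - T w) (Num.sqrt (1 - s)) (ract z (ascal A t))
  (@l2norm_ge0 R A) (l2norm0 A) (@l2norm_le0 R A) (@complete_l2norm R A).
- by move=> u l Ru; exact: l2closed_lim.
- by case: sF.
- by move=> x Rx; apply: submoduleB => //; apply/RM; exists (G x).
- by move=> x y _ _; rewrite TB !opprB addrACA [in RHS]addrACA (addrC (- y)).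
- by rewrite sqrtr_ge0 -[ltRHS]sqrtr1 ltr_sqrt//; lra.
- exact: contr.
- by case: sF.
- exact: RM.
- by move=> x; exact: submoduleN.
move=> w Rw; rewrite opprB addrC subrK => e; exists w => //.
have := congr1 (fun x => ract x (ascal A t^-1)) e.
by rewrite /T !ractK// gt_eqF.
Qed.

(** If [F (G y) = F (G x)], then [<G (x - y), G (x - y)> = <x - y, F (G (x - y))> = 0], so [x - y]
    is orthogonal to the range. *)
Lemma range_complemented x : exists2 y, range F y &
  forall w, range F w -> inner w (x - y) = 0.
Proof.
have [y Ry e] := @range_adjoint_onto (F (G x)) ltac:(by exists (G x)).
exists y => // _ [u _ <-]; rewrite FG.
have -> : G (x - y) = 0; last exact: inner0r.
apply: inner_eq0.
by rewrite (is_adjoint_sym FG) adjB adjB e subrr inner0r.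
Qed.

(** If [F (G w) = F x], then [x - G w] is in the kernel, and [G w] is orthogonal to it as a value of
    the adjoint. *)
Lemma ker_complemented x : exists2 y, ker F y &
  forall w, ker F w -> inner w (x - y) = 0.
Proof.
have [w Rw e] := @range_adjoint_onto (F x) ltac:(by exists x).
exists (x - G w); first by apply/kerE; rewrite adjB e subrr.
by move=> v /kerE v0; rewrite opprB addrC subrK -FG v0 inner0l.
Qed.

(** The preimage is [G w] with [F (G w) = F x]: its squared norm is that of [<w, F x>], and
    [l2norm w <= C * l2norm (G w)]. *)
Lemma open_mapping : exists2 C, 0 <= C &
  forall x, exists2 x', F x' = F x & l2norm x' <= C * l2norm (F x).
Proof.
have [C C1 GC] := adjoint_bounded_below; exists C; first lra.
move=> x; have [w Rw e] := @range_adjoint_onto (F x) ltac:(by exists x).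
exists (G w) => //; have := GC w Rw.
have := cauchy_schwarz w (F (G w)); rewrite -(is_adjoint_sym FG) -l2norm_sqr e.
have := l2norm_ge0 (F x); have := l2norm_ge0 w; have := l2norm_ge0 (G w).
rewrite le_eqVlt => /orP[/eqP <- *|G0 w0 Fx0 h1 h2].
  by rewrite mulr_ge0//; lra.
rewrite -(ler_pM2l G0) -expr2; apply: (le_trans h1).
by rewrite mulrA (mulrC (l2norm (G w))); apply: ler_wpM2r.
Qed.

End ClosedRange.

End Adjointable.

(** * Projections and angles *)

Lemma subrACA (V : zmodType) (a b c d : V) :
  a - b - (c - d) = a - c - (b - d).
Proof. by rewrite !opprB addrACA [in RHS]addrACA (addrC (- b)). Qed.

Section Projection.
Variables (R : realType) (A : cstarAlgType R).
Variables (X : set (l2 A)) (P : l2 A -> l2 A).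
Implicit Types (x y z w : l2 A) (a : A).
Hypothesis X_sub : submodule X.
Hypothesis P_proj : forall x, X (P x) /\ forall w, X w -> inner w (x - P x) = 0.

Lemma proj_in x : X (P x). Proof. by case: (P_proj x). Qed.

Lemma inner_proj w x : X w -> inner w (P x) = inner w x.
Proof.
by case: (P_proj x) => _ H /H; rewrite innerBr => /subr0_eq.
Qed.

Lemma proj_uniq x y : X y -> (forall w, X w -> inner w y = inner w x) -> P x = y.
Proof.
move=> Xy H; apply/subr0_eq/inner_eq0; rewrite innerBr inner_proj ?H ?subrr//;
  exact: (submoduleB X_sub (proj_in x) Xy).
Qed.

Lemma proj_id x : X x -> P x = x.
Proof. by move=> Xx; exact: proj_uniq. Qed.

Lemma projB x y : P (x - y) = P x - P y.
Proof.
apply: proj_uniq => [|w Xw]; first exact: (submoduleB X_sub (proj_in x) (proj_in y)).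
by rewrite !innerBr !inner_proj.
Qed.

Lemma projM x a : P (ract x a) = ract (P x) a.
Proof.
apply: proj_uniq => [|w Xw]; first by case: X_sub => _ _; apply; exact: proj_in.
by rewrite !innerMr inner_proj.
Qed.

Lemma inner_proj_proj x : inner (P x) x = inner (P x) (P x).
Proof. by rewrite (inner_proj _ (proj_in x)). Qed.

Lemma pythagoras x :
  inner (x - P x) (x - P x) = inner x x - inner (P x) (P x).
Proof.
have h w : X w -> inner (x - P x) w = 0.
  by move=> Xw; rewrite -innerC (P_proj x).2 ?star0.
rewrite innerBr (h (P x) (proj_in x)) subr0 innerBl.
by rewrite inner_proj_proj.
Qed.

Lemma l2norm_proj x : l2norm (P x) <= l2norm x.
Proof.
apply/ler_wsqrtr/pos_le; first exact: pos_inner.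
by rewrite -pythagoras; exact: pos_inner.
Qed.

Lemma l2norm_projC x : l2norm (x - P x) <= l2norm x.
Proof.
apply/ler_wsqrtr/pos_le; first exact: pos_inner.
by rewrite pythagoras opprB addrC subrK; exact: pos_inner.
Qed.

Lemma rnorm_inner_proj x y : X x ->
  rnorm (inner y x) <= l2norm (P y) * l2norm x.
Proof.
move=> Xx; rewrite -rnorm_star innerC -inner_proj// -innerC rnorm_star.
exact: cauchy_schwarz.
Qed.

End Projection.

Section Angle.
Variables (R : realType) (A : cstarAlgType R).
Implicit Types (X Y Z : set (l2 A)) (P Q : l2 A -> l2 A) (x y z w : l2 A).

(** Homogeneous form of the angle condition, by rescaling nonzero vectors to norm 1. The extended
    real [c0 X Y] is finite because it lies between 0, attained at zero vectors, and 1. *)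
Lemma dixmier_angle_posP X Y : submodule X -> submodule Y ->
  dixmier_angle_pos X Y <-> exists2 c : R, 0 <= c < 1 &
    forall x y, X x -> Y y -> rnorm (inner x y) <= c * (l2norm x * l2norm y).
Proof.
move=> [X0 _ XM] [Y0 _ YM]; split=> [pXY|[c /andP[c0 c1] H]]; last first.
  apply: (@le_lt_trans _ _ c%:E); last by rewrite lte_fin.
  apply: ge_ereal_sup => _ [x [y [Xx Yy x1 y1 ->]]]; rewrite lee_fin.
  apply: (le_trans (H x y Xx Yy)); apply: ler_piMr => //.
  by apply: mulr_ile1 => //; exact: l2norm_ge0.
have ub x y : X x -> Y y -> l2norm x <= 1 -> l2norm y <= 1 ->
    ((rnorm (inner x y))%:E <= c0 X Y)%E.
  by move=> Xx Yy x1 y1; apply: ereal_sup_ubound; exists x, y; split.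
have c0_ge0 : (0 <= c0 X Y)%E.
  have := ub 0 0 X0 Y0; rewrite !l2norm0 inner0r rnorm0; exact.
have [c cE] : exists c : R, c0 X Y = c%:E.
  by move: pXY c0_ge0; rewrite /dixmier_angle_pos; case: (c0 X Y) => [c| |] // _ _; exists c.
exists c.
  by move: pXY c0_ge0; rewrite /dixmier_angle_pos cE lte_fin lee_fin => -> ->.
move=> x y Xx Yy.
have [x0|x0] := eqVneq (l2norm x) 0.
  have -> : x = 0 by apply: l2norm_le0; rewrite x0.
  by rewrite inner0l rnorm0 l2norm0 mul0r mulr0.
have [y0|y0] := eqVneq (l2norm y) 0.
  have -> : y = 0 by apply: l2norm_le0; rewrite y0.
  by rewrite inner0r rnorm0 l2norm0 !mulr0.
have xp : 0 < l2norm x by rewrite lt_def x0 l2norm_ge0.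
have yp : 0 < l2norm y by rewrite lt_def y0 l2norm_ge0.
have xV : 0 <= (l2norm x)^-1 by rewrite invr_ge0 ltW.
have yV : 0 <= (l2norm y)^-1 by rewrite invr_ge0 ltW.
have := ub _ _ (XM x (ascal A (l2norm x)^-1) Xx) (YM y (ascal A (l2norm y)^-1) Yy).
rewrite !l2norm_scale !ger0_norm// !mulVf// => /(_ (lexx _) (lexx _)).
rewrite cE lee_fin innerMl innerMr star_ascal ascalMl ascalMr !rnormZ !ger0_norm//.
by rewrite ler_pdivrMl// ler_pdivrMl// mulrA mulrC (mulrC (l2norm y)).
Qed.

(* The projection onto [X] maps [Y `&` orth Z] into [X `&` orth Z]. *)
Lemma dixmier_angle_pos_swap X Y Z P : submodule X -> submodule Y ->
  (forall x, X (P x) /\ forall w, X w -> inner w (x - P x) = 0) ->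
  Z `<=` X ->
  dixmier_angle_pos (X `&` orth Z) Y -> dixmier_angle_pos (Y `&` orth Z) X.
Proof.
move=> sX sY PX ZX; have oZ := submodule_orth Z.
move=> /(dixmier_angle_posP (submoduleI sX oZ) sY)[c c01 H].
apply/(dixmier_angle_posP (submoduleI sY oZ) sX); exists c => // y x [Yy Zy] Xx.
apply: (le_trans (rnorm_inner_proj PX _ Xx)).
rewrite mulrA; apply: ler_wpM2r; first exact: l2norm_ge0.
have Py : (X `&` orth Z) (P y).
  split=> [|z Zz]; first exact: (proj_in PX).
  by rewrite (inner_proj PX _ (ZX _ Zz)) Zy.
(* [<P y, y> = <P y, P y>], so the angle bound becomes [l2norm (P y) <= c * l2norm y]. *)
have := H _ _ Py Yy; rewrite (inner_proj_proj PX) -l2norm_sqr.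
have := l2norm_ge0 (P y); rewrite le_eqVlt => /orP[/eqP <- _|P0].
  by rewrite mulr_ge0 ?l2norm_ge0//; case/andP: c01.
by rewrite expr2 mulrCA ler_pM2l.
Qed.

End Angle.

(** * Closed range of [D \o F] and the angle between [M] and [ker D] *)

Section ClosedComposition.
Variables (R : realType) (A : cstarAlgType R) (F D : adjointable A).
Hypotheses (F_closed : l2closed (range F)) (D_closed : l2closed (range D)).
Implicit Types (x y z w : l2 A).

Let K := ker D.
Let N := range F.
Let M := N `&` orth (K `&` N).

Let sK : submodule K. Proof. exact: submodule_ker. Qed.
Let sN : submodule N. Proof. exact: submodule_range. Qed.
Let sM : submodule M.
Proof. by apply: submoduleI => //; exact: submodule_orth. Qed.

Lemma ex_proj_ker : exists P : l2 A -> l2 A,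
  forall x, K (P x) /\ forall w, K w -> inner w (x - P x) = 0.
Proof.
have [E DE] := ex_adjoint D.
suff H x : exists y, K y /\ forall w, K w -> inner w (x - y) = 0.
  by have [f fP] := choice H; exists f.
by have [y ? ?] := ker_complemented DE D_closed x; exists y.
Qed.

Lemma ex_proj_range : exists Q : l2 A -> l2 A,
  forall x, N (Q x) /\ forall w, N w -> inner w (x - Q x) = 0.
Proof.
have [G FG] := ex_adjoint F.
suff H x : exists y, N y /\ forall w, N w -> inner w (x - y) = 0.
  by have [f fP] := choice H; exists f.
by have [y ? ?] := range_complemented FG F_closed x; exists y.
Qed.

Lemma angle_pos_of_closed :
  l2closed (range (D \o F)) -> dixmier_angle_pos M K.
Proof.
move=> DF_closed; have [P PK] := ex_proj_ker.
have [DF DFE] := ex_comp D F.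
have [H DFH] := ex_adjoint DF.
have [|C C0 openDF] := open_mapping DFH.
  by rewrite (_ : adj_fun DF = D \o F)//; exact/funext.
have [k k1 Fk] := adj_bound F; have [l l1 Dl] := adj_bound D.
(* The product bounds the chain [y], [F u'], [u'], [D (y - P y)], [y - P y]; adding 1 ensures
   [B >= 1], so that [1 - B^-2] is nonnegative. *)
pose B := k * C * l + 1.
have B1 : 1 <= B by rewrite /B lerDr !mulr_ge0//; lra.
have below y : M y -> l2norm y <= B * l2norm (y - P y).
  move=> [[u _ uy] oy].
  (* [F u'] differs from [y] by an element of [K] and [N], to which [y] is orthogonal, so
     [l2norm y <= l2norm (F u')]. *)
  have [u' u'E nu'] := openDF u; rewrite !DFE uy in u'E nu'.
  have Ky : (K `&` N) (F u' - y).
    split; first by apply/kerE; rewrite adjB u'E subrr.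
    by rewrite -uy -adjB; exists (u' - u).
  have nFu : l2norm y <= l2norm (F u').
    have := cauchy_schwarz (F u') y.
    have /subr0_eq -> : inner (F u') y - inner y y = 0.
      by rewrite -innerBl oy.
    rewrite -l2norm_sqr; have := l2norm_ge0 y.
    rewrite le_eqVlt => /orP[/eqP <- _|y0]; first exact: l2norm_ge0.
    by rewrite expr2 ler_pM2r.
  have DPy : D y = D (y - P y).
    by rewrite adjB ((kerE D (P y)).1 (proj_in PK y)) subr0.
  have h1 := Fk u'; have h2 := Dl (y - P y); rewrite -DPy in h2.
  have h3 : k * l2norm u' <= k * (C * (l * l2norm (y - P y))).
    apply: ler_wpM2l; first lra.
    by apply: (le_trans nu'); apply: ler_wpM2l.
  have := l2norm_ge0 (y - P y); rewrite /B mulrDl mul1r -!mulrA; lra.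
have cmp := inner_le_of_l2norm sM (ltac:(lra) : 0 <= B) (fun x a _ => erefl)
  (T := fun y => y - P y) _ below.
have {}cmp y : M y ->
    pos ((B ^+ 2)%:C *: inner (y - P y) (y - P y) - inner y y).
  apply: cmp => x a _; rewrite (projM sK PK).
  by apply: l2_eq => i /=; rewrite mulrBl.
pose s : R := (B ^+ 2)^-1.
have B2 : 1 <= B ^+ 2 by nra.
have s0 : 0 < s by rewrite invr_gt0; lra.
have s1 : s <= 1 by rewrite invf_le1//; lra.
apply/(dixmier_angle_posP sM sK); exists (Num.sqrt (1 - s)).
  by rewrite sqrtr_ge0 -[ltRHS]sqrtr1 ltr_sqrt//; lra.
move=> y x My Kx; apply: (le_trans (rnorm_inner_proj PK _ Kx)).
rewrite mulrA; apply: ler_wpM2r; first exact: l2norm_ge0.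
rewrite -sqrtrM; last lra.
apply: ler_wsqrtr; rewrite -[1 - s]ger0_norm; last lra.
rewrite -rnormZ; apply: pos_le; first exact: pos_inner.
have := posZ (ltW s0) (cmp y My).
rewrite scalerBr scalerRA mulVf ?scale1r; last by rewrite gt_eqF//; lra.
by rewrite (pythagoras PK) rmorphB scalerBl scale1r addrAC.
Qed.

(* For [x] in [N], alternating projections split [x] into its limit, fixed by
   [Q \o P] and hence in [K `&` N], and an element of [M]. *)
Lemma range_split : dixmier_angle_pos M K ->
  forall x, N x -> exists2 m, M m & (K `&` N) (x - m).
Proof.
move=> /(dixmier_angle_posP sM sK)[c /andP[c0 c1] Hc] x Nx.
have [P PK] := ex_proj_ker; have [Q QN] := ex_proj_range.
have QPM y : N y -> (forall z, (K `&` N) z -> inner z (y - Q (P y)) = 0).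
  move=> Ny z [Kz Nz].
  by rewrite innerBr (inner_proj QN)// (inner_proj PK)// subrr.
have MQP y : M y -> M (Q (P y)).
  move=> [Ny oy]; split; first exact: (proj_in QN).
  move=> z KNz; have := QPM y Ny z KNz.
  by rewrite innerBr oy// sub0r => /eqP; rewrite oppr_eq0 => /eqP.
have contr y : M y -> l2norm (Q (P y)) <= c * l2norm y.
  move=> My; apply: (le_trans (l2norm_proj QN _)).
  have := Hc _ _ My (proj_in PK y).
  rewrite -rnorm_star innerC (inner_proj_proj PK) -l2norm_sqr.
  have := l2norm_ge0 (P y); rewrite le_eqVlt => /orP[/eqP <- _|P0].
    by rewrite mulr_ge0// l2norm_ge0.
  by rewrite expr2 mulrA ler_pM2r.
have [] := @neumann_solve R (l2 A) (fun x => l2norm x) (@l2norm_group R A)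
  M (fun y => Q (P y)) c (x - Q (P x))
  (@l2norm_ge0 R A) (l2norm0 A) (@l2norm_le0 R A) (@complete_l2norm R A).
- move=> u m Mu; apply: l2closed_lim => //.
  by apply: l2closedI => //; exact: l2closed_orth.
- by case: sM.
- exact: MQP.
- by move=> y z _ _; rewrite (projB sK PK) (projB sN QN).
- by rewrite c0.
- exact: contr.
- by case: sM.
- split; last exact: QPM.
  exact: (submoduleB sN Nx (proj_in QN _)).
- by move=> y; exact: submoduleN.
move=> m Mm e; exists m => //.
set y := x - m.
have Ny : N y by apply: (submoduleB sN Nx); case: Mm.
have fixy : Q (P y) = y.
  rewrite /y (projB sK PK) (projB sN QN).
  by apply/esym/subr0_eq; rewrite subrACA e subrr.
split => //.
(* As [y] is in [N], [<y, P y> = <y, Q (P y)> = <y, y>], and Pythagoras makes [y - P y] vanish. *)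
have Py : P y = y.
  apply/esym/subr0_eq/inner_eq0; rewrite (pythagoras PK).
  have yPy : inner y (P y) = inner y y.
    by rewrite -{4}fixy (inner_proj QN).
  by rewrite -(inner_proj_proj PK) -(innerC y (P y)) yPy innerC subrr.
by rewrite -Py; exact: (proj_in PK).
Qed.

(** By [range_split] the approximants of [x] may be taken in [D M]. Since [D] is bounded below on
    [M], their preimages there form a Cauchy sequence, whose limit stays in the closed submodule
    [M]. *)
Lemma closed_of_angle_pos :
  dixmier_angle_pos M K -> l2closed (range (D \o F)).
Proof.
move=> pMK; have split_ := range_split pMK.
move: pMK => /(dixmier_angle_posP sM sK)[c /andP[c0 c1] Hc].
have [P PK] := ex_proj_ker; have [E DE] := ex_adjoint D.
have [C C0 openD] := open_mapping DE D_closed.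
have below m : M m -> (1 - c) * l2norm m <= C * l2norm (D m).
  move=> Mm.
  have Pm : l2norm (P m) <= c * l2norm m.
    have := Hc _ _ Mm (proj_in PK m).
    rewrite -rnorm_star innerC (inner_proj_proj PK) -l2norm_sqr.
    have := l2norm_ge0 (P m); rewrite le_eqVlt => /orP[/eqP <- _|P0].
      by rewrite mulr_ge0// l2norm_ge0.
    by rewrite expr2 mulrA ler_pM2r.
  (* The small preimage [m'] of [D m] differs from [m] by an element of [K], so both have the same
     component orthogonal to [K], of norm at most [l2norm m']. *)
  have [m' Dm' nm'] := openD m.
  have Kmm : K (m - m') by apply/kerE; rewrite adjB Dm' subrr.
  have mm : m - P m = m' - P m'.
    have := proj_id sK PK Kmm; rewrite (projB sK PK) => e.
    by apply/subr0_eq; rewrite subrACA e subrr.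
  have := l2norm_projC PK m'; rewrite -mm.
  have := l2normD (m - P m) (P m); rewrite subrK; lra.
move=> x ad.
have /choice[m Hm] n : exists m, M m /\ l2norm (x - D m) < n.+1%:R^-1.
  have [|_ [u _ <-] xu] := ad (n.+1%:R^-1); first by rewrite invr_gt0.
  have [m Mm [/kerE Dum _]] := split_ (F u) ltac:(by exists u).
  exists m; split=> //; move: Dum; rewrite adjB => /subr0_eq <-.
  exact: xu.
have Dm_x : tends_to (fun y : l2 A => l2norm y) (fun n => D (m n)) x.
  move=> e e0; exists (Num.truncn e^-1) => n n0n.
  rewrite (gnormB_sym (@l2norm_group R A)).
  apply: (lt_trans (Hm n).2); rewrite invf_plt ?posrE//.
  by apply: lt_le_trans (truncnS_gt _) _; rewrite ler_nat.
have [e e0|l ml] := @complete_l2norm _ _ m.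
  have C1 : 0 < C + 1 by lra.
  have c1' : 0 < 1 - c by lra.
  have [n0 Hn0] := tends_to_cauchy (@l2norm_group R A) Dm_x
    ltac:(by apply: (divr_gt0 (mulr_gt0 e0 c1') C1)).
  exists n0 => p n n0p n0n; have := Hn0 p n n0p n0n; rewrite -adjB.
  have := below _ (submoduleB sM (Hm p).1 (Hm n).1).
  have := l2norm_ge0 (D (m p - m n)).
  rewrite ltr_pdivlMr// => h1 h2 h3; rewrite -(ltr_pM2l c1'); nra.
have [Nl _] : M l.
  apply: (l2closed_lim _ (fun n => (Hm n).1) ml).
  by apply: l2closedI => //; exact: l2closed_orth.
have [k k1 Dk] := adj_bound D.
have -> : x = D l.
  apply: (tends_to_unique (@l2norm_group R A) (@l2norm_le0 R A) Dm_x) => e e0.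
  have k0 : 0 < k by lra.
  have [n0 Hn0] := ml _ (divr_gt0 e0 k0); exists n0 => n /Hn0.
  rewrite ltr_pdivlMr// mulrC -adjB; exact: le_lt_trans.
by case: Nl => u _ <-; exists u.
Qed.

End ClosedComposition.

Theorem corollary3p18 (R : realType) (A : cstarAlgType R)
    (F D : adjointable A)
    (F_closed : l2closed (range F)) (D_closed : l2closed (range D)) :
  let M := range F `&` orth (ker D `&` range F) in
  let M' := ker D `&` orth (ker D `&` range F) in
  [<-> l2closed (range (D \o F));
       dixmier_angle_pos M' (range F);
       dixmier_angle_pos M (ker D)].
Proof.
move=> M M'; have sK := submodule_ker D; have sN := submodule_range F.
tfae.
(* Closedness first gives the angle between [M] and [ker D]; the swap by the projection onto the
   range of [F] moves it to [M']. *)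
- move=> /(angle_pos_of_closed D_closed).
  have [Q QN] := ex_proj_range F_closed.
  by apply: (dixmier_angle_pos_swap sN sK QN) => x [].
- have [P PK] := ex_proj_ker D_closed.
  by apply: (dixmier_angle_pos_swap sK sN PK) => x [].
- exact: closed_of_angle_pos.
Qed.
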